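(* Let $N\ge2$ and let $\Omega\subset\mathbb{R}^N$ be a bounded and smooth domain. Let $\rho(x)=\inf_{y\in\partial\Omega}|y-x|$, $x\in\overline\Omega$, be the distance function to the boundary. Then $$\lim_{p\to\infty}\Lambda_p(\Omega)^{\frac1p}=\lim_{p\to\infty}\Lambda_p(\Omega)^{\frac1p}|\Omega|^{-\frac1p}=\frac1{\|\rho\|_\infty}.$$
   Context: $|\Omega|$ is the Lebesgue measure of $\Omega$ and $\|\cdot\|_s$ the norm of $L^s(\Omega)$. For $p>N$, $\Lambda_p(\Omega)=\min\{\|\nabla u\|_p^p:u\in W_0^{1,p}(\Omega),\ \|u\|_\infty=1\}$ (equivalently, $\Lambda_p(\Omega)=\lim_{q\to\infty}\inf\{\|\nabla u\|_p^p:u\in W_0^{1,p}(\Omega),\ \|u\|_q=1\}$); the minimum is attained. *)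

(* Defs.v *)
From HB Require Import structures.
From mathcomp Require Import all_boot all_order all_algebra.
From mathcomp Require Import all_classical all_reals all_analysis.

Set Implicit Arguments.
Unset Strict Implicit.
Unset Printing Implicit Defensive.

Import Order.TTheory GRing.Theory Num.Theory.
Import numFieldNormedType.Exports.

Local Open Scope classical_set_scope.
Local Open Scope ring_scope.

(* R^N is 'rV[R]_N.  Its library norm is the sup norm; the topology is the
   usual one, but all the lengths below are Euclidean. *)
Definition enorm (R : realType) (n : nat) (x : 'rV[R]_n) : R :=
  Num.sqrt (\sum_(i < n) x ord0 i ^+ 2).

(* The sigma-algebra of R^N generated by the coordinates, which is the Borel
   one. *)
Definition rV_display : measure_display -> measure_display.
Proof. exact. Qed.

Section rV_measurable.
Context {R : realType} (n : nat).

Definition rV_coord (i : 'I_n) (x : 'rV[R]_n) : R := x ord0 i.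

Let rV_set0 : g_sigma_preimage rV_coord set0.
Proof. exact: sigma_algebra0. Qed.

Let rV_setC A : g_sigma_preimage rV_coord A -> g_sigma_preimage rV_coord (~` A).
Proof. exact: sigma_algebraC. Qed.

Let rV_bigcup (F : _^nat) : (forall i, g_sigma_preimage rV_coord (F i)) ->
  g_sigma_preimage rV_coord (\bigcup_i (F i)).
Proof. exact: sigma_algebra_bigcup. Qed.

HB.instance Definition _ := @isMeasurable.Build (rV_display default_measure_display)
  'rV[R]_n (g_sigma_preimage rV_coord) rV_set0 rV_setC rV_bigcup.

End rV_measurable.

(* (v, x) |-> (x, v_1, ..., v_n) *)
Definition rV_cons (R : realType) (n : nat)
    (vx : 'rV[R]_n * measurableTypeR R) : 'rV[R]_n.+1 :=
  \row_(i < n.+1) if unlift ord0 i is Some j then vx.1 ord0 j else vx.2.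

Section rV_product.
Context {R : realType} (n : nat).

Let rV_cons_measurable : measurable_fun setT (@rV_cons R n).
Proof.
apply: (measurability (\big[setU/set0]_(i < n.+1)
  preimage_set_system setT (@rV_coord R n.+1 i) measurable)) => // _ [A + <-].
rewrite -bigcup_seq => -[i _ [B mB <-]].
rewrite !setTI; case: (unliftP (ord0 : 'I_n.+1) i) => [j|] ->.
- have -> : @rV_cons R n @^-1` (rV_coord (lift ord0 j) @^-1` B) =
            fst @^-1` (@rV_coord R n j @^-1` B).
    by apply/seteqP; split=> -[v x]; rewrite /preimage /rV_coord /= mxE liftK.
  rewrite -[X in measurable X]setTI; apply: measurable_fst => //.
  apply: sub_sigma_algebra; rewrite -bigcup_seq; exists j.
    by rewrite /= mem_index_enum.
  by exists B => //; rewrite setTI.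
- have -> : @rV_cons R n @^-1` (rV_coord ord0 @^-1` B) = snd @^-1` B.
    by apply/seteqP; split=> -[v x];
      rewrite /preimage /rV_coord /= mxE unlift_none.
  by rewrite -[X in measurable X]setTI; exact: measurable_snd.
Qed.

HB.instance Definition _ :=
  isMeasurableFun.Build _ _ _ _ (@rV_cons R n) rV_cons_measurable.

Definition rV_product (m : {measure set 'rV[R]_n -> \bar R}) :
    set 'rV[R]_n.+1 -> \bar R :=
  pushforward (m \x @lebesgue_measure R)%E (@rV_cons R n).

Variable m : {measure set 'rV[R]_n -> \bar R}.

Let rV_product0 : rV_product m set0 = 0%E.
Proof. exact: measure0. Qed.

Let rV_product_ge0 A : (0 <= rV_product m A)%E.
Proof. exact: measure_ge0. Qed.

Let rV_product_sigma_additive : semi_sigma_additive (rV_product m).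
Proof. exact: measure_semi_sigma_additive. Qed.

HB.instance Definition _ := isMeasure.Build _ _ _ (rV_product m)
  rV_product0 rV_product_ge0 rV_product_sigma_additive.

End rV_product.

(* n-dimensional Lebesgue measure (on the Borel sets), as an iterated product;
   the measure of R^0 is the unit mass at its only point. *)
Fixpoint leb (R : realType) (n : nat) : {measure set 'rV[R]_n -> \bar R} :=
  if n is n'.+1 then rV_product (leb R n') else dirac (0 : 'rV[R]_0).

Section calculus.
Context {R : realType} (n : nat).
Implicit Types (f : 'rV[R]_n -> R) (Omega : set 'rV[R]_n).

Definition pderive (i : 'I_n) f : 'rV[R]_n -> R :=
  fun x => 'D_(delta_mx ord0 i) f x.

Definition grad f : 'rV[R]_n -> 'rV[R]_n := fun x => \row_i pderive i f x.

(* C^infinity: the iterated partial derivatives along every word of indices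
   exist and are continuous. *)
Definition smooth f := forall s : seq 'I_n,
  let g := foldr pderive f s in
  continuous g /\ forall (i : 'I_n) x, derivable g x (delta_mx ord0 i).

(* C_c^infinity(Omega) *)
Definition test_function Omega f :=
  [/\ smooth f, compact (closure [set x | f x != 0])
    & closure [set x | f x != 0] `<=` Omega].

End calculus.

(* Locally, after relabelling and possibly reversing the coordinate axes,
   Omega is the region above the graph of a C^infinity function of the
   remaining coordinates. *)
Definition smooth_boundary (R : realType) (N : nat) (Omega : set 'rV[R]_N) :=
  forall x0, (closure Omega `\` Omega°) x0 ->
  exists (i : 'I_N) (b : bool) (gamma : 'rV[R]_N.-1 -> R),
    smooth gamma /\
    \forall x \near x0, Omega x <-> gamma (col' i x) < (-1) ^+ b * x ord0 i.

Definition bdist (R : realType) (N : nat) (Omega : set 'rV[R]_N)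
    (x : 'rV[R]_N) : R :=
  inf [set enorm (y - x) | y in closure Omega `\` Omega°].

Section sobolev.
Context {R : realType} (N : nat).
Implicit Types (Omega : set 'rV[R]_N) (p : R).
Implicit Types (u : 'rV[R]_N -> R) (G : 'rV[R]_N -> 'rV[R]_N).

(* The norm of L^s(Omega), 1 <= s <= +oo.  Functions are defined on R^N, only
   their values on Omega matter: f \_ Omega vanishes outside Omega. *)
Definition Ls_norm Omega (s : \bar R) u : \bar R :=
  'N[leb R N]_s [(EFin \o u) \_ Omega]%E.

Definition in_Ls Omega (s : \bar R) u :=
  measurable_fun Omega u /\ (Ls_norm Omega s u < +oo)%E.

Definition weak_gradient Omega u G := forall (i : 'I_N) phi,
  test_function Omega phi ->
  \int[leb R N]_(x in Omega) (u x * pderive i phi x) =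
  - \int[leb R N]_(x in Omega) (G x ord0 i * phi x).

(* u belongs to W^{1,p}(Omega) and G is its gradient. *)
Definition W1p Omega p u G :=
  [/\ in_Ls Omega p%:E u,
      forall i : 'I_N, in_Ls Omega p%:E (fun x => G x ord0 i)
    & weak_gradient Omega u G].

Definition W1p_norm Omega p u G : \bar R :=
  (Ls_norm Omega p%:E u + Ls_norm Omega p%:E (fun x => enorm (G x)))%E.

(* W_0^{1,p}(Omega), the closure of C_c^infinity(Omega) in W^{1,p}(Omega). *)
Definition W01p Omega p u G :=
  W1p Omega p u G /\
  forall e : R, 0 < e -> exists2 phi, test_function Omega phi &
    (W1p_norm Omega p (fun x => u x - phi x)%R
       (fun x => G x - grad phi x)%R < e%:E)%E.

Definition Lambda Omega p : \bar R :=
  ereal_inf [set y | exists u G, [/\ W01p Omega p u G,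
    Ls_norm Omega +oo%E u = 1%E
    & y = (Ls_norm Omega p%:E (fun x => enorm (G x)) `^ p)%E]].

End sobolev.

(* Main.v *)
Require Import Defs.
From HB Require Import structures.
From mathcomp Require Import all_boot all_order all_algebra.
From mathcomp Require Import all_classical all_reals all_analysis.
From mathcomp Require Import measurable_realfun ess_sup_inf.
From mathcomp Require Import ring lra.

Set Implicit Arguments.
Unset Strict Implicit.
Unset Printing Implicit Defensive.

Import Order.TTheory GRing.Theory Num.Theory.
Import numFieldNormedType.Exports.

Local Open Scope classical_set_scope.
Local Open Scope ring_scope.

(** Write [r] for the inradius [||rho||_oo].  Upper bound: smoothing the
    cone [(r - |x - x0|)^+], where [x0] nearly maximises [rho], gives test
    functions [u] with [||u||_oo = 1] and [|grad u| <= 1 / (r - e)] everywhere,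
    so that [Lambda_p^(1/p) <= |Omega|^(1/p) / (r - e)], and
    [|Omega|^(1/p) -> 1].  Lower bound: let [x] be in [Omega] and [y] a nearest
    boundary point.  A test function [phi] vanishes at [y]; comparing [phi x]
    and [phi y] with the mean of [phi] over a cube of side [d] placed at the
    midpoint of [x] and [y], the argument of Morrey's inequality gives
    [|phi x| <= (r + 2 d sqrt N) d^(-N/p) / (1 - N/p) ||grad phi||_p].
    By density and Markov's inequality this passes to [W_0^{1,p}]; now let
    [p -> oo], then [d -> 0]. *)

(** The limit is sharp, so the constant in Morrey's inequality must tend to the inradius itself. A
    cube of side comparable to [|x - y|] would leave a factor depending on N. The side d is
    therefore kept independent of x and y: for fixed d the factor d^(-N/p) / (1 - N/p) tends to 1 as
    p -> oo, and only the additive loss 2 d sqrt N remains. Test functions are extended by zero to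
    R^N, so neither the segment from x to y nor the cubes have to stay in Omega. Morrey's inequality
    is proved for test functions only, and elements of W_0^{1,p} get no continuous representative:
    where [|u|] is close to 1, a set of positive measure, a test function bounded by less than 1
    stays away from u, against approximation in L^p. The cone is smoothed by formulas rather than by
    convolution: its apex by replacing |x - x0| with sqrt (delta^2 + |x - x0|^2), its rim by
    replacing t^+ with t exp(-eta/t). Both keep slopes at most 1, and smoothness of all orders comes
    from a class of explicit functions closed under partial derivatives. *)

(** * Borel measurability in R^N *)

Section rV_measurability.
Context {R : realType}.

Lemma measurable_rV_coord n (i : 'I_n) : measurable_fun setT (@rV_coord R n i).
Proof.
move=> _ B mB; apply: sub_sigma_algebra; rewrite -bigcup_seq; exists i.
  by rewrite /= mem_index_enum.
by exists B => //; rewrite setTI.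
Qed.

Lemma measurable_fun_rV d (T : measurableType d) n (f : T -> 'rV[R]_n) :
  (forall i, measurable_fun setT (fun x => f x ord0 i)) ->
  measurable_fun setT f.
Proof.
move=> mf; apply: (measurability (\big[setU/set0]_(i < n)
  preimage_set_system setT (@rV_coord R n i) measurable)) => // _ [A + <-].
rewrite -bigcup_seq => -[i _ [B mB <-]].
rewrite !setTI; have := mf i measurableT B mB; rewrite setTI.
exact.
Qed.

(* A union of the boxes with rational centre and radius 1/(k+1) that it
   contains. *)
Lemma open_measurable_rV n (U : set 'rV[R]_n) : open U -> measurable U.
Proof.
move=> oU.
pose B (qk : 'rV[rat]_n * nat) : set 'rV[R]_n :=
  \bigcap_(i : 'I_n) (@rV_coord R n i @^-1`
    (ball (ratr (qk.1 ord0 i) : R) (qk.2.+1%:R^-1))).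
have mB qk : measurable (B qk).
  apply: fin_bigcap_measurable => // i _.
  rewrite -[X in measurable X]setTI; apply: measurable_rV_coord => //.
  exact: measurable_ball.
pose F qk := if `[< B qk `<=` U >] then B qk else set0.
have -> : U = \bigcup_qk F qk.
  apply/seteqP; split=> [x Ux|x [qk _]]; last first.
    by rewrite /F; case: asboolP => // BU; exact: BU.
  have /nbhs_ballP[e /= e0 xeU] : nbhs x U by exact: open_nbhs_nbhs.
  have [k /= ke] : exists k : nat, k.+1%:R^-1 < e / 2.
    have [k _ kP] := near_infty_natSinv_lt (PosNum (divr_gt0 e0 (ltr0Sn R 1))).
    by exists k; apply: (kP k) => /=.
  have k0 : 0 < k.+1%:R^-1 :> R by rewrite invr_gt0.
  have /choice[q qP] (i : 'I_n) : exists q : rat,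
      ball (ratr q : R) k.+1%:R^-1 (x ord0 i).
    have [q] := @rat_in_itvoo R (x ord0 i) (x ord0 i + k.+1%:R^-1) (ltac:(by rewrite ltrDl)).
    rewrite in_itv /= => /andP[xq qx]; exists q.
    by rewrite /ball /= ger0_norm ?subr_ge0 ?(ltW xq)// ltrBlDl.
  exists (\row_i q i, k) => //; rewrite /F; case: asboolP => [_ i _|[y By]].
    by rewrite /rV_coord /= mxE; exact: qP.
  apply: xeU; split=> // i j; rewrite ord1.
  have := By j I; rewrite /rV_coord /= mxE => yq.
  have := ball_triangle (ball_sym (qP j)) yq.
  by apply: le_ball; move: (_^-1) ke => r ke; lra.
apply: countable_bigcupT_measurable => // qk; rewrite /F.
by case: asboolP.
Qed.

Lemma continuous_measurable_rV n (f : 'rV[R]_n -> R) :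
  continuous f -> measurable_fun setT f.
Proof.
move=> cf; apply: (measurability _ (RGenOpens.measurableE R)).
move=> _ [_ [a [b ->] <-]]; rewrite setTI.
by apply: open_measurable_rV; move/continuousP : cf; apply; exact: interval_open.
Qed.

Lemma measurable_rV_affine n (a : 'rV[R]_n) (s : R) :
  measurable_fun setT (fun z : 'rV[R]_n => a + s *: z).
Proof.
apply: measurable_fun_rV => i.
rewrite (_ : (fun _ => _) = (fun z => a ord0 i + s * rV_coord i z)); last first.
  by apply/funext => z; rewrite !mxE.
apply: measurable_funD => //; apply: measurable_funM => //.
exact: measurable_rV_coord.
Qed.

End rV_measurability.

(** * Lebesgue measure of cubes and affine changes of variables *)

Section lebesgue_affine.
Context {R : realType}.

Definition raffine (a s : R) (x : measurableTypeR R) : measurableTypeR R :=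
  a + s * x.

Lemma measurable_raffine a s : measurable_fun setT (raffine a s).
Proof. by apply: measurable_funD => //; exact: measurable_funM. Qed.

(** The image of Lebesgue measure under [x |-> a + s x], multiplied by [s], gives each []x, y]] its
    length, hence is Lebesgue measure by uniqueness; integrating against it is the change of
    variables. *)
Lemma lebesgue_affine (a s : R) (f : measurableTypeR R -> \bar R) : 0 < s ->
  measurable_fun setT f -> (forall x, 0 <= f x)%E ->
  (s%:E * \int[lebesgue_measure]_x f (a + s * x)%R =
   \int[lebesgue_measure]_x f x)%E.
Proof.
move=> s0 mf f0.
pose mu0 : {measure set (measurableTypeR R) -> \bar R} :=
  mscale (NngNum (ltW s0)) (pushforward lebesgue_measure (raffine a s)).
pose mu := mu0 (measurable_raffine a s).
have muE A : measurable A -> lebesgue_measure A = mu A.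
  apply: lebesgue_measure_unique => _ [[x y] _ <-].
  rewrite /mu /= /mscale /= /pushforward.
  have -> : raffine a s @^-1` `]x, y] = `](x - a) / s, (y - a) / s]%classic.
    apply/seteqP; split=> z; rewrite /preimage /raffine /= !in_itv /=
      ltr_pdivrMr// ler_pdivlMr// (mulrC z); lra.
  rewrite !lebesgue_measure_itv /= !lte_fin ltr_pM2r ?invr_gt0// ltrD2r.
  case: ifP => _; last by rewrite mule0.
  by rewrite -!EFinB -EFinM; congr EFin; field; rewrite gt_eqF.
transitivity (\int[mu]_x f x)%E; last first.
  by apply: eq_measure_integral => A mA _; exact/esym/muE.
rewrite ge0_integral_mscale//= ge0_integral_pushforward//.
exact: measurable_raffine.
Qed.

End lebesgue_affine.

Section leb_theory.
Context {R : realType}.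

Definition ccube n (a : 'rV[R]_n) (s : R) : set 'rV[R]_n :=
  [set x | forall i, a ord0 i <= x ord0 i <= a ord0 i + s].

Lemma measurable_ccube n (a : 'rV[R]_n) s : measurable (ccube a s).
Proof.
have -> : ccube a s = \bigcap_(i : 'I_n)
    (@rV_coord R n i @^-1` `[a ord0 i, a ord0 i + s]%classic).
  apply/seteqP; split=> [x xa i _|x xa i].
    by rewrite /= in_itv /=; exact: xa.
  by have := xa i I; rewrite /= in_itv.
apply: fin_bigcap_measurable => // i _.
by rewrite -[X in measurable X]setTI; exact: measurable_rV_coord.
Qed.

Lemma leb_ccube n (a : 'rV[R]_n) (s : R) : 0 <= s ->
  leb R n (ccube a s) = (s ^+ n)%:E.
Proof.
move=> s0; elim: n a => [|n IH] a.
  rewrite /= /dirac indicE mem_set ?expr0// => i; by case: i.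
rewrite /= /rV_product /pushforward.
pose a' : 'rV[R]_n := \row_j a ord0 (lift ord0 j).
have -> : @rV_cons R n @^-1` (ccube a s) =
    ccube a' s `*` `[a ord0 ord0, a ord0 ord0 + s]%classic.
  apply/seteqP; split=> -[v x] /=.
    move=> H; split=> [i|].
      by have := H (lift ord0 i); rewrite !mxE liftK.
    by have := H ord0; rewrite !mxE unlift_none in_itv.
  rewrite in_itv /= => -[H1 H2] i.
  rewrite !mxE; case: unliftP => [j|] ->//.
  by have := H1 j; rewrite !mxE.
rewrite product_measure1E//; last exact: measurable_ccube.
rewrite IH /= lebesgue_measure_itv /= lte_fin ltrDl.
case: ifPn => [_|]; first by rewrite -EFinB -EFinM exprSr addrAC subrr add0r.
rewrite -leNgt => s_le0; have -> : s = 0 by apply/le_anti; rewrite s_le0 s0.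
by rewrite mule0 exprSr mulr0.
Qed.

Lemma leb_sigma_finite n : sigma_finite setT (leb R n).
Proof.
exists (fun k => ccube (const_mx (- k%:R)) (k%:R *+ 2)); last first.
  by move=> k; rewrite leb_ccube ?mulrn_wge0 ?ler0n// ltry; split=> //;
    exact: measurable_ccube.
apply/esym/seteqP; split=> // x _.
have [k xk] : exists k : nat, `|x| < k%:R.
  by exists (Num.truncn `|x|).+1; exact: truncnS_gt.
exists k => // i; rewrite mxE mulr2n addrA addNr add0r -ler_norml.
by apply/ltW/(le_lt_trans _ xk); rewrite [leRHS]mx_normrE; apply: le_bigmax (ord0, i).
Qed.

(** Tonelli's theorem asks for a sigma-finite structure; [leb] is a fixpoint with values in bundled
    measures, so the structure is attached to this alias of the underlying function. *)
Let sfleb n : set 'rV[R]_n -> \bar R := leb R n.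

HB.instance Definition _ n := Measure.copy (@sfleb n) (leb R n).

HB.instance Definition _ n := Measure_isSigmaFinite.Build _ _ _ (@sfleb n)
  (@leb_sigma_finite n).

Lemma ge0_integral_lebS n (f : 'rV[R]_n.+1 -> \bar R) :
  measurable_fun setT f -> (forall x, 0 <= f x)%E ->
  (\int[leb R n.+1]_x f x =
   \int[leb R n]_v \int[lebesgue_measure]_x f (rV_cons (v, x)))%E.
Proof.
move=> mf f0.
rewrite [LHS](@ge0_integral_pushforward _ _ _ _ _ (@rV_cons R n))//.
rewrite preimage_setT (@fubini_tonelli1 _ _ _ _ _ (@sfleb n) _ (f \o @rV_cons R n))//.
  by apply: measurableT_comp.
by move=> x; exact: f0.
Qed.

(** Induction on the dimension: Tonelli splits off the first coordinate, [lebesgue_affine] rescales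
    it, and the induction hypothesis rescales the others. The Jacobian [s ^+ n] is the origin of the
    factor [d ^- n] in Morrey's inequality. *)
Lemma ge0_integral_leb_affine n (a : 'rV[R]_n) (s : R)
    (f : 'rV[R]_n -> \bar R) : 0 < s ->
  measurable_fun setT f -> (forall x, 0 <= f x)%E ->
  ((s ^+ n)%:E * \int[leb R n]_z f (a + s *: z)%R = \int[leb R n]_z f z)%E.
Proof.
move=> s0; elim: n a f => [|n IH] a f mf f0.
  rewrite expr0 mul1e /=; apply: eq_integral => x _; congr f.
  by apply/rowP => -[].
have maff := measurable_rV_affine a s.
rewrite ge0_integral_lebS//; last exact: measurableT_comp.
rewrite [RHS]ge0_integral_lebS//.
pose a' : 'rV[R]_n := \row_j a ord0 (lift ord0 j).
pose g v := (\int[lebesgue_measure]_x f (rV_cons (v, x)))%E.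
have mg : measurable_fun setT g.
  apply: (measurable_fun_fubini_tonelli_F (f \o @rV_cons R n)).
    exact: measurableT_comp.
  by move=> x; exact: f0.
have g0 v : (0 <= g v)%E by apply: integral_ge0.
rewrite -(IH a' g)// exprSr EFinM -muleA; congr (_ * _)%E.
rewrite -ge0_integralZl//.
- apply: eq_integral => v _; rewrite /g.
  rewrite -(@lebesgue_affine R (a ord0 ord0) s
    (fun x => f (rV_cons (a' + s *: v, x))))//; last first.
    apply: (measurableT_comp mf).
    apply: measurable_fun_rV => i.
    case: (unliftP ord0 i) => [j ->|->].
      rewrite (_ : (fun _ => _) = cst ((a' + s *: v) ord0 j))//.
      by apply/funext => x; rewrite mxE liftK.
    rewrite (_ : (fun _ => _) = id); first exact: measurable_id.
    by apply/funext => x; rewrite mxE unlift_none.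
  congr (_ * _)%E; apply: eq_integral => x _; congr f.
  by apply/rowP => i; rewrite !mxE; case: unliftP => [j|] -> //=; rewrite !mxE.
- apply: (measurable_fun_fubini_tonelli_F
    (fun vx => f (a + s *: rV_cons vx))); last by move=> x; exact: f0.
  apply: (measurableT_comp mf).
  by apply: (@measurableT_comp _ _ _ _ _ _ _ _ (@rV_cons R n) maff).
- by move=> v _; apply: integral_ge0.
- by rewrite lee_fin ltW.
Qed.

End leb_theory.

(** * Directional derivatives *)

Section derivatives.
Context {R : realType} {V : normedModType R}.
Implicit Types (f : V -> R) (x v : V) (d : R).

(** Clearing the quotient makes [h = 0] harmless and lets errors of the form [e * |h|] be added,
    which is how several derivatives below are computed. *)
Lemma is_derive_epsP f x v d : is_derive x v f d <->
  forall e, 0 < e -> exists2 r, 0 < r &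
    forall h, `|h| < r -> `|f (x + h *: v) - f x - h * d| <= e * `|h|.
Proof.
pose q h := h^-1 *: ((f \o shift x) (h *: v) - f x).
have qE h : h != 0 ->
    `|d - q h| = `|f (x + h *: v) - f x - h * d| / `|h|.
  move=> h0; rewrite /q -normfV -normrM distrC /= (addrC x) /GRing.scale /=.
  by congr (`| _ |); field.
have -> : is_derive x v f d <-> q @ 0^' --> d.
  split=> [[df <-]|qd]; first exact: df.
  by apply: DeriveDef; [apply/cvg_ex; exists d|exact/cvg_lim].
split=> [/cvgrPdist_le H e e0|H].
  have /nbhs_ballP[r /= r0 rP] := H _ e0.
  exists r => // h hr; have [->|h0] := eqVneq h 0.
    by rewrite scale0r addr0 subrr mul0r subr0 normr0 mulr0.
  have := rP h; rewrite /ball /= sub0r normrN => /(_ hr h0).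
  by rewrite qE// ler_pdivrMr// normr_gt0.
apply/cvgrPdist_le => e e0; have [r r0 rP] := H _ e0.
apply/nbhs_ballP; exists r => // h; rewrite /ball /= sub0r normrN => hr h0.
by rewrite qE// ler_pdivrMr ?normr_gt0// rP.
Qed.

End derivatives.

Section lines.
Context {R : realType} {V : normedModType R}.
Implicit Types (f : V -> R) (x v : V) (d : R).

Lemma is_derive_line f (a v : V) (t d : R) :
  is_derive (a + t *: v) v f d -> is_derive t (1 : R) (fun s => f (a + s *: v)) d.
Proof.
move=> /is_derive_epsP H; apply/is_derive_epsP => e /H[r r0 rP]; exists r => // h hr.
rewrite (_ : a + (t + h *: 1) *: v = a + t *: v + h *: v); first exact: rP.
by rewrite -addrA -scalerDl; congr (_ + (_ + _) *: _); exact: mulr1.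
Qed.

End lines.

Lemma is_derive1_continuous {R : realType} (f : R -> R) (x d : R) :
  is_derive x 1 f d -> {for x, continuous f}.
Proof.
by move=> /(@ex_derive _ _ _ _ _ _ _)/derivable1_diffP/differentiable_continuous.
Qed.

(** Either sign of [t] is allowed because the increments to which this is applied are products
    [h * c] of unknown sign. *)
Lemma mean_value {R : realType} (f df : R -> R) (t : R) :
  (forall s : R, is_derive s (1 : R) f (df s)) ->
  exists2 c, `|c| <= `|t| & f t - f 0 = t * df c.
Proof.
move=> fdf; have cf : continuous f.
  by move=> s; exact: is_derive1_continuous (fdf s).
have cfw (a b : R) : {within `[a, b], continuous f}.
  exact: continuous_subspaceT.
have [t0|t0] := leP 0 t.
  have [c] := MVT_segment t0 (fun s _ => fdf s) (cfw _ _).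
  rewrite in_itv /= subr0 => /andP[c0 ct] ->; exists c; last by rewrite mulrC.
  by rewrite !ger0_norm// (le_trans c0).
have [c] := MVT_segment (ltW t0) (fun s _ => fdf s) (cfw _ _).
rewrite in_itv /= sub0r => /andP[tc c0] fE; exists c.
  by rewrite !ler0_norm ?lerN2// (ltW t0).
by rewrite -[LHS]opprB fE mulrN opprK mulrC.
Qed.

Section directional.
Context {R : realType} {V : normedModType R}.
Implicit Types (f : V -> R) (x v : V) (d : R).

(** The step from [x] to [x + h (v + c e)] is made first along [v], then along [e]. The first leg
    uses the derivative at [x]; on the second the mean value theorem yields ['D_e f] at a nearby
    point, which continuity at [x] compares with ['D_e f x]. *)
Lemma is_derive_addZ f x v (e : V) d (c : R) :
  (forall y, derivable f y e) -> {for x, continuous ('D_e f)} ->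
  is_derive x v f d -> is_derive x (v + c *: e) f (d + c * 'D_e f x).
Proof.
move=> dfe cfe /is_derive_epsP H; apply/is_derive_epsP => eps eps0.
have eps2 : 0 < eps / 2 by lra.
have [r r0 rP] := H _ eps2.
have C0 : 0 < `|c| + 1 by rewrite ltr_wpDl.
have /cvgrPdist_le/(_ (eps / 2 / (`|c| + 1)) (divr_gt0 eps2 C0)) := cfe.
move=> /nbhs_ballP[r' /= r'0 r'P].
(* [|h| * M] bounds the distance from [x] to the intermediate point of the second leg; the added 1
   keeps [M] positive. *)
pose M := `|v| + `|c| * `|e| + 1.
have M0 : 0 < M by rewrite ltr_wpDl// addr_ge0// mulr_ge0.
exists (Num.min r (r' / M)); first by rewrite lt_min r0 divr_gt0.
move=> h; rewrite lt_min => /andP[hr hr'].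
have {rP} := rP h hr.
have [s cs] := @mean_value R (fun s => f ((x + h *: v) + s *: e))
  (fun s => 'D_e f ((x + h *: v) + s *: e)) (h * c)
  (fun s => is_derive_line (derivableP (dfe _))).
rewrite scale0r addr0 scalerDr scalerA addrA => fE fvE.
have near : ball x r' (x + h *: v + s *: e).
  rewrite -ball_normE /= opprD addrA opprD addrA subrr sub0r.
  rewrite -opprD normrN (le_lt_trans (ler_normD _ _))// !normrZ.
  rewrite normrM in cs.
  apply: (@le_lt_trans _ _ (`|h| * M)); last by rewrite -ltr_pdivlMr.
  rewrite /M !mulrDr mulr1 mulrA; have := normr_ge0 h.
  have := ler_wpM2r (normr_ge0 e) cs; lra.
have {near} := r'P _ near; rewrite ler_pdivlMr// distrC.
set D := 'D_e f x in fE *; set D' := 'D_e f _ in fE *.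
move=> DD'.
have -> : f (x + h *: v + (h * c) *: e) - f x - h * (d + c * D) =
  (f (x + h *: v) - f x - h * d) + h * c * (D' - D).
  by rewrite mulrBr -fE; ring.
rewrite (le_trans (ler_normD _ _))// (splitr eps) mulrDl lerD//.
rewrite !normrM -mulrA mulrC ler_wpM2r// mulrC (le_trans _ DD')//.
by rewrite ler_wpM2l// lerDl.
Qed.

End directional.

(** * The Euclidean norm *)

Section enorm_theory.
Context {R : realType} {n : nat}.
Implicit Types (x y : 'rV[R]_n).

Lemma enorm_ge0 x : 0 <= enorm x.
Proof. exact: sqrtr_ge0. Qed.

Lemma sqr_enorm x : enorm x ^+ 2 = \sum_i x ord0 i ^+ 2.
Proof. by rewrite sqr_sqrtr// sumr_ge0// => i _; exact: sqr_ge0. Qed.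

Lemma enorm0 : enorm (0 : 'rV[R]_n) = 0.
Proof. by rewrite /enorm big1 ?sqrtr0// => i _; rewrite mxE expr0n. Qed.

Lemma enormZ (c : R) x : enorm (c *: x) = `|c| * enorm x.
Proof.
rewrite /enorm -sqrtr_sqr -sqrtrM ?sqr_ge0// mulr_sumr.
by congr Num.sqrt; apply: eq_bigr => i _; rewrite mxE exprMn.
Qed.

Lemma enormN x : enorm (- x) = enorm x.
Proof. by rewrite -scaleN1r enormZ normrN1 mul1r. Qed.

Lemma enormB x y : enorm (x - y) = enorm (y - x).
Proof. by rewrite -enormN opprB. Qed.

Lemma coord_le_enorm x i : `|x ord0 i| <= enorm x.
Proof.
rewrite -sqrtr_sqr ler_wsqrtr// (bigD1 i)//= lerDl sumr_ge0// => j _.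
exact: sqr_ge0.
Qed.

Lemma enorm_eq0 x : enorm x = 0 -> x = 0.
Proof.
move=> x0; apply/rowP => i; rewrite mxE; apply/normr0_eq0/le_anti.
by rewrite normr_ge0 andbT -x0; exact: coord_le_enorm.
Qed.

(** Expanding the nonnegative sum of the squares [(|y| x_i - |x| y_i)^2] gives
    [2 |x|^2 |y|^2 - 2 |x| |y| (x . y)]; dividing by [|x| |y|] requires nonzero norms, hence the two
    separate cases. *)
Lemma cauchy_schwarz x y :
  \sum_i x ord0 i * y ord0 i <= enorm x * enorm y.
Proof.
have [x0|x0] := eqVneq (enorm x) 0.
  by rewrite x0 mul0r (enorm_eq0 x0) big1// => i _; rewrite mxE mul0r.
have [y0|y0] := eqVneq (enorm y) 0.
  by rewrite y0 mulr0 (enorm_eq0 y0) big1// => i _; rewrite mxE mulr0.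
have AB : 0 < enorm x * enorm y.
  by rewrite mulr_gt0// lt_neqAle eq_sym ?x0 ?y0 enorm_ge0.
have : 0 <= \sum_i (enorm y * x ord0 i - enorm x * y ord0 i) ^+ 2.
  by apply: sumr_ge0 => i _; exact: sqr_ge0.
have -> : \sum_i (enorm y * x ord0 i - enorm x * y ord0 i) ^+ 2 =
  enorm y ^+ 2 * enorm x ^+ 2 + enorm x ^+ 2 * enorm y ^+ 2
  - 2 * (enorm x * enorm y) * \sum_i x ord0 i * y ord0 i.
  rewrite [in X in X * enorm x ^+ 2]sqr_enorm -[in RHS]sqr_enorm.
  rewrite [X in enorm y ^+ 2 * X]sqr_enorm [X in enorm x ^+ 2 * X]sqr_enorm.
  rewrite !mulr_sumr -big_split -sumrB /=; apply: eq_bigr => i _; ring.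
move: (\sum_i _) AB => s; move: (enorm x) (enorm y) => A B AB H.
rewrite -(ler_pM2l AB); lra.
Qed.

Lemma ler_enormD x y : enorm (x + y) <= enorm x + enorm y.
Proof.
rewrite -(@ler_pXn2r _ 2) ?nnegrE ?addr_ge0 ?enorm_ge0//.
rewrite sqr_enorm sqrrD !sqr_enorm.
have -> : \sum_i (x + y) ord0 i ^+ 2 = \sum_i x ord0 i ^+ 2 +
  (\sum_i x ord0 i * y ord0 i) *+ 2 + \sum_i y ord0 i ^+ 2.
  rewrite -mulr_natl mulr_sumr -!big_split /=; apply: eq_bigr => i _.
  by rewrite mxE; ring.
by rewrite lerD2r lerD2l ler_pMn2r// cauchy_schwarz.
Qed.

Lemma normr_sum_le x y :
  `|\sum_i x ord0 i * y ord0 i| <= enorm x * enorm y.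
Proof.
rewrite ler_norml cauchy_schwarz andbT lerNl.
have := cauchy_schwarz (- x) y; rewrite enormN; congr (_ <= _).
by rewrite -sumrN; apply: eq_bigr => i _; rewrite mxE mulNr.
Qed.

Lemma enorm_le_sqrt x (M : R) : 0 <= M -> (forall i, `|x ord0 i| <= M) ->
  enorm x <= M * Num.sqrt n%:R.
Proof.
move=> M0 xM; rewrite -[in leRHS](ger0_norm M0) -sqrtr_sqr -sqrtrM ?sqr_ge0//.
rewrite ler_wsqrtr// mulr_natr -[in leRHS](card_ord n) -sumr_const.
by apply: ler_sum => i _; rewrite -real_normK ?num_real// lerXn2r ?nnegrE.
Qed.

Lemma enorm_le_norm x : enorm x <= `|x| * Num.sqrt n%:R.
Proof.
apply: enorm_le_sqrt => // i.
by rewrite [leRHS]mx_normrE; apply: le_bigmax (ord0, i).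
Qed.

Lemma norm_le_enorm x : `|x| <= enorm x.
Proof.
rewrite [leLHS]mx_normrE; apply: bigmax_le => [|[i j] _]; first exact: enorm_ge0.
by rewrite ord1; exact: coord_le_enorm.
Qed.

Lemma enorm_lipschitz x y : `|enorm x - enorm y| <= enorm (x - y).
Proof.
rewrite ler_norml; apply/andP; split.
  by have := ler_enormD (y - x) x; rewrite subrK enormB; lra.
by have := ler_enormD (x - y) y; rewrite subrK; lra.
Qed.

(* The domain of f carries the sup norm, whence the constant sqrt n. *)
Lemma lipschitz_enorm_continuous (f : 'rV[R]_n -> R) :
  (forall x y, `|f x - f y| <= enorm (x - y)) -> continuous f.
Proof.
move=> fL x; apply/(@cvgrPdist_le _ _ _ _ (nbhs_filter x)) => e e0.
pose M : R := Num.sqrt n%:R + 1.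
have M0 : 0 < M by rewrite ltr_wpDl.
apply/nbhs_ballP; exists (e / M); first exact: divr_gt0.
move=> y; rewrite -ball_normE /= => xy.
rewrite (le_trans (fL _ _))// (le_trans (enorm_le_norm _))//.
rewrite (@le_trans _ _ (`|x - y| * M))// ?ler_wpM2l ?lerDl//.
by rewrite -ler_pdivlMr// ltW.
Qed.

Lemma continuous_enormB (x0 : 'rV[R]_n) : continuous (fun x => enorm (x - x0)).
Proof.
apply: lipschitz_enorm_continuous => x y.
by rewrite (le_trans (enorm_lipschitz _ _))// opprB addrA subrK.
Qed.

End enorm_theory.

(** * C^1 functions, the chain rule and derivatives under the integral sign *)

Section C1_functions.
Context {R : realType} {n : nat}.
Implicit Types (f : 'rV[R]_n -> R) (x v : 'rV[R]_n).

Definition C1 f := [/\ continuous f,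
  forall i x, derivable f x (delta_mx ord0 i)
  & forall i, continuous (pderive i f)].

Lemma smooth_C1 f : smooth f -> C1 f.
Proof.
move=> sf; have [cf df] := sf [::]; split=> // i.
by have [] := sf [:: i].
Qed.

(** The direction [v] is built up one coordinate at a time by [is_derive_addZ], whose continuity
    hypothesis is that of the partial derivatives. *)
Lemma is_derive_C1 f x v : C1 f ->
  is_derive x v f (\sum_i v ord0 i * pderive i f x).
Proof.
move=> [_ df cf].
have -> : v = \sum_i v ord0 i *: delta_mx ord0 i by exact: row_sum_delta.
rewrite [X in is_derive _ _ _ X](_ : _ =
    \sum_i v ord0 i * 'D_(delta_mx ord0 i) f x); last first.
  by apply: eq_bigr => i _; rewrite -row_sum_delta.
elim/big_rec2 : _ => [|i d w _ H]; first exact: is_derive0.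
rewrite [X in is_derive _ X]addrC [X in is_derive _ _ _ X]addrC.
by apply: is_derive_addZ => //; exact: cf.
Qed.

Lemma grad_le f x v :
  `|\sum_i v ord0 i * pderive i f x| <= enorm v * enorm (grad f x).
Proof.
have := normr_sum_le v (grad f x); congr (`| _ | <= _).
by apply: eq_bigr => i _; rewrite mxE.
Qed.

Lemma continuous_enorm_grad f : C1 f -> continuous (fun x => enorm (grad f x)).
Proof.
move=> [_ _ cf]; have cs : continuous (fun x => \sum_i pderive i f x ^+ 2).
  apply: (@continuous_big R _ +%R 0 xpredT) => [|i _ x].
    exact: add_continuous.
  exact: (cvgM (cf i x) (cf i x)).
rewrite (_ : (fun x => _) = Num.sqrt \o (fun x => \sum_i pderive i f x ^+ 2)).
  by move=> x; apply: continuous_comp; [exact: cs|exact: sqrt_continuous].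
by apply/funext => x; congr Num.sqrt; apply: eq_bigr => i _; rewrite mxE.
Qed.

End C1_functions.

(** Only a directional derivative of [w] is given, so the one-variable chain rule is applied on the
    line [s |-> w (x + s v)]. *)
Lemma is_derive_comp {R : realType} {V : normedModType R} (g : R -> R)
    (w : V -> R) (x v : V) (a b : R) :
  is_derive (w x) (1 : R) g a -> is_derive x v w b ->
  is_derive x v (g \o w) (a * b).
Proof.
move=> dg dw.
have dw0 : is_derive (0 : R) (1 : R) (fun s : R => w (x + s *: v)) b.
  by apply: is_derive_line; rewrite scale0r addr0.
have : is_derive (0 : R) (1 : R) (g \o (fun s : R => w (x + s *: v))) (a * b).
  by apply: is_derive1_comp; rewrite scale0r addr0.
move=> /is_derive_epsP H; apply/is_derive_epsP => e /H[r r0 rP].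
exists r => // h hr; have := rP h hr; rewrite /= add0r scale0r addr0.
by rewrite (_ : h *: (1 : R) = h)//; exact: mulr1.
Qed.

Lemma bounded_integrable {d} {T : measurableType d} {R : realType}
    (mu : {measure set T -> \bar R}) (A : set T) (f : T -> R) (M : R) :
  measurable A -> (mu A < +oo)%E -> measurable_fun A f ->
  (forall x, A x -> `|f x| <= M) -> mu.-integrable A (EFin \o f).
Proof.
move=> mA Afin mf fM; apply: measurable_bounded_integrable => //.
exists M; split; first exact: num_real.
by move=> K MK x Ax; exact: le_trans (fM _ Ax) (ltW MK).
Qed.

Section integral_derivative.
Context {R : realType} {n : nat}.
Variables (phi : 'rV[R]_n -> R) (M K : R).
Hypotheses (phiC1 : C1 phi) (phiM : forall x, `|phi x| <= M)
  (gradK : forall x, enorm (grad phi x) <= K).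

(** The derivative of the integrand is dominated by the constant [|A| * |K|], integrable since [B]
    has finite measure. The general path [p z + s q z] covers two uses: cubes shrinking to a point,
    and translations along an axis. *)
Lemma is_derive_integral_line (B : set 'rV[R]_n) (p q : 'rV[R]_n -> 'rV[R]_n)
    (A t : R) : measurable B -> (leb R n B < +oo)%E ->
  measurable_fun setT p -> measurable_fun setT q ->
  (forall z, B z -> enorm (q z) <= A) ->
  is_derive t (1 : R)
    (fun s => \int[leb R n]_(z in B) phi (p z + s *: q z))
    (\int[leb R n]_(z in B)
      \sum_i q z ord0 i * pderive i phi (p z + t *: q z)).
Proof.
move=> mB Bfin mp mq qA.
have [cphi _ _] := phiC1.
have mline s : measurable_fun setT (fun z => p z + s *: q z).
  apply: measurable_fun_rV => i.
  rewrite (_ : (fun _ => _) =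
      (fun z => rV_coord i (p z) + s * rV_coord i (q z))); last first.
    by apply/funext => z; rewrite !mxE.
  apply: measurable_funD; last apply: measurable_funM => //.
    by apply: measurableT_comp => //; exact: measurable_rV_coord.
  by apply: measurableT_comp => //; exact: measurable_rV_coord.
pose f s z := phi (p z + s *: q z).
have dfz s z : is_derive s (1 : R) (f ^~ z)
    (\sum_i q z ord0 i * pderive i phi (p z + s *: q z)).
  by apply: is_derive_line; exact: is_derive_C1.
have d1f s z : partial1of2 f s z =
    \sum_i q z ord0 i * pderive i phi (p z + s *: q z).
  by rewrite /partial1of2 derive1E; exact: (@derive_val _ _ _ _ _ _ _ (dfz s z)).
have -> : \int[leb R n]_(z in B)
    \sum_i q z ord0 i * pderive i phi (p z + t *: q z) =
  \int[leb R n]_(z in B) partial1of2 f t z.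
  by apply: eq_Rintegral => z _; rewrite d1f.
have It : `]t - 1, t + 1[%classic t by rewrite /= in_itv /=; lra.
have intf s : `]t - 1, t + 1[%classic s ->
    (leb R n).-integrable B (EFin \o f s).
  move=> _; apply: (@bounded_integrable _ _ _ _ _ _ M) => //.
    apply: measurable_funTS; apply: (measurableT_comp _ (mline s)).
    exact: continuous_measurable_rV.
  by move=> z _; exact: phiM.
have derf : forall (s : R) (z : 'rV[R]_n), `]t - 1, t + 1[%classic s -> B z ->
    derivable (f ^~ z) s (1 : R).
  by move=> s z _ _; exact: (@ex_derive _ _ _ _ _ _ _ (dfz s z)).
have G0 (z : 'rV[R]_n) : 0 <= `|A| * `|K| by rewrite mulr_ge0.
have intG : (leb R n).-integrable B (EFin \o (fun=> `|A| * `|K|)).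
  by apply: (@bounded_integrable _ _ _ _ _ _ (`|A| * `|K|)) => // z _;
    rewrite ger0_norm.
have Gub s z : `]t - 1, t + 1[%classic s -> B z ->
    `|partial1of2 f s z| <= `|A| * `|K|.
  move=> _ Bz; rewrite d1f (le_trans (grad_le _ _ _))//.
  by apply: ler_pM; rewrite ?enorm_ge0// (le_trans _ (ler_norm _))// qA.
apply: DeriveDef.
  exact: (derivable_under_integral mB It intf derf G0 intG Gub).
by rewrite -derive1E; exact: (differentiation_under_integral mB It intf derf G0 intG Gub).
Qed.

End integral_derivative.

(** * Morrey's inequality on cubes *)

(** Hoelder's inequality for [f] and the indicator of [B], whose norm in the conjugate exponent is 1
    because [B] has mass 1. *)
Lemma power_mean_le {d} {T : measurableType d} {R : realType}
    (mu : {measure set T -> \bar R}) (B : set T) (f : T -> R) (p : R) :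
  measurable B -> mu B = 1%E -> measurable_fun setT f ->
  (forall x, 0 <= f x) -> 1 < p ->
  (\int[mu]_(x in B) (f x)%:E <=
   (\int[mu]_(x in B) (f x `^ p)%:E) `^ p^-1)%E.
Proof.
move=> mB B1 mf f0 p1.
have p0 : 0 < p by lra.
pose q := (1 - p^-1)^-1.
have q'0 : 0 < 1 - p^-1 by rewrite subr_gt0 invf_lt1.
have q0 : 0 < q by rewrite invr_gt0.
have pq : p^-1 + q^-1 = 1 by rewrite /q invrK; ring.
have mfB : measurable_fun setT (f \_ B).
  apply/(measurable_restrictT f mB); exact: measurable_funTS.
have m1 : measurable_fun setT (\1_B : T -> R) by exact: measurable_indic.
have := hoelder mu mfB m1 p0 q0 pq.
rewrite Lnorm1 Lnorm.unlock.
have -> : (\int[mu]_x `|(EFin \o (f \_ B \* \1_B)%R) x| =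
    \int[mu]_(x in B) (f x)%:E)%E.
  rewrite [RHS]integral_mkcond; apply: eq_integral => x _ /=.
  rewrite !patchE indicE; case: (x \in B) => /=; last by rewrite mulr0 normr0.
  by rewrite mulr1 ger0_norm.
have -> : (\int[mu]_x `|(EFin \o (f \_ B)%R) x| `^ p =
    \int[mu]_(x in B) (f x `^ p)%:E)%E.
  rewrite [RHS]integral_mkcond; apply: eq_integral => x _ /=.
  rewrite !patchE; case: (x \in B) => /=; first by rewrite ger0_norm.
  by rewrite normr0 powR0// gt_eqF.
have -> : (\int[mu]_x `|(EFin \o (\1_B : T -> R)) x| `^ q = 1)%E.
  rewrite (eq_integral (fun x => (\1_B x)%:E)) => [|x _ /=].
    by rewrite integral_indic// setIT.
  rewrite indicE; case: (x \in B) => /=; first by rewrite normr1 powR1.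
  by rewrite normr0 powR0// gt_eqF.
by rewrite poweR1r mule1.
Qed.

(** [c / alpha * t^alpha] is a primitive of the bound. For [alpha < 1] the bound may blow up at 0,
    so the comparison is made on [[e, 1]], and continuity of [F] at 0 lets [e] shrink. *)
Lemma power_growth {R : realType} (F dF : R -> R) (c alpha : R) :
  (forall t : R, is_derive t (1 : R) F (dF t)) -> 0 < alpha -> 0 <= c ->
  (forall t : R, 0 < t -> `|dF t| <= c * t `^ (alpha - 1)) ->
  `|F 1 - F 0| <= c / alpha.
Proof.
move=> dFE a0 c0 dFle.
pose H t := c / alpha * t `^ alpha.
have dH (t : R) : 0 < t -> is_derive t (1 : R) H (c * t `^ (alpha - 1)).
  move=> t0.
  have -> : c * t `^ (alpha - 1) = (c / alpha) *: (alpha * t `^ (alpha - 1)).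
    by rewrite /GRing.scale /= mulrA divfK// gt_eqF.
  exact: (@is_deriveZ _ _ _ (@powR R ^~ alpha) _ t 1 _ (is_derive1_powR alpha t0)).
(* [s = 1] and [s = -1] give the two halves of the absolute value; the nonnegative term [H e] is
   dropped. *)
have main (s e : R) : `|s| = 1 -> 0 < e < 1 -> s * (F 1 - F e) <= c / alpha.
  move=> s1 /andP[e0 e1].
  have dG (t : R) : 0 < t ->
      is_derive t (1 : R) (fun t => s * F t - H t)
        (s * dF t - c * t `^ (alpha - 1)).
    by move=> t0; apply: (@is_deriveB _ _ _ (s \*: F) H _ _ _ _ _ (dH _ t0)).
  have [t||z] := @MVT R (fun t => s * F t - H t)
    (fun t => s * dF t - c * t `^ (alpha - 1)) e 1 e1.
  - by rewrite in_itv /= => /andP[et _]; apply: dG; exact: lt_trans et.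
  - apply: continuous_in_subspaceT => t; rewrite inE /= in_itv /= => /andP[et _].
    by apply: is_derive1_continuous (dG t _); exact: lt_le_trans et.
  rewrite in_itv /= => /andP[ez z1] E.
  have z0 : 0 < z by exact: lt_trans ez.
  have : s * dF z <= c * z `^ (alpha - 1).
    by rewrite (le_trans _ (dFle _ z0))// (le_trans (ler_norm _))// normrM s1 mul1r.
  have H1 : H 1 = c / alpha by rewrite /H powR1 mulr1.
  have He : 0 <= H e by rewrite /H mulr_ge0 ?powR_ge0// divr_ge0// ltW.
  move=> le0.
  have : s * F 1 - H 1 - (s * F e - H e) <= 0.
    by rewrite E mulr_le0_ge0//; lra.
  rewrite H1; lra.
apply/ler_addgt0Pr => e e0.
have /cvgrPdist_le/(_ _ e0)/nbhs_ballP[r /= r0 rP] := is_derive1_continuous (dFE 0).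
pose t := Num.min (r / 2) (1 / 2).
have tP : 0 < t < 1 by rewrite lt_min gt_min; lra.
have tr : ball 0 r t.
  rewrite /ball /= sub0r normrN gtr0_norm; last by case/andP: tP.
  by rewrite gt_min; lra.
have {tr} := rP _ tr; rewrite distrC => Ft.
have := main 1 t (normr1 R) tP; have := main (-1) t (normrN1 R) tP.
rewrite !mul1r mulN1r => h1 h2.
have h : `|F 1 - F t| <= c / alpha by rewrite ler_norml; lra.
have -> : F 1 - F 0 = (F 1 - F t) + (F t - F 0) by ring.
by rewrite (le_trans (ler_normD _ _))// lerD.
Qed.

Section morrey.
Context {R : realType} {n : nat}.
Local Notation Q := (ccube (0 : 'rV[R]_n) 1).

Lemma leb_unit_cube : leb R n Q = 1%E.
Proof. by rewrite leb_ccube// expr1n. Qed.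

(** After [power_mean_le] on the unit cube, the integral over [Q] is enlarged to the whole space,
    where the substitution [x = b + s z] produces [s ^- n]. *)
Lemma cube_average_le (g : 'rV[R]_n -> R) (b : 'rV[R]_n) (s p I : R) :
  continuous g -> (forall x, 0 <= g x) -> 0 < s -> 1 < p ->
  (\int[leb R n]_x (g x `^ p)%:E = I%:E)%E ->
  (\int[leb R n]_(z in Q) (g (b + s *: z)%R)%:E <=
    ((s ^- n * I) `^ p^-1)%:E)%E.
Proof.
move=> cg g0 s0 p1 gI.
have mQ := @measurable_ccube R n 0 1.
have mgs : measurable_fun setT (fun z : 'rV[R]_n => g (b + s *: z)).
  apply: (measurableT_comp _ (measurable_rV_affine b s)).
  exact: continuous_measurable_rV.
have mgp : measurable_fun setT (fun x : 'rV[R]_n => (g x `^ p)%:E).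
  apply/measurable_EFinP; rewrite (_ : (fun _ => _) = (@powR R ^~ p) \o g)//.
  by apply: measurableT_comp; [exact: measurable_powR|exact: continuous_measurable_rV].
apply: (le_trans (power_mean_le mQ leb_unit_cube mgs (fun z => g0 _) p1)).
rewrite -poweR_EFin; apply: gt0_ler_poweR.
- by rewrite invr_ge0; lra.
- by rewrite in_itv /= leey andbT integral_ge0// => z _; rewrite lee_fin powR_ge0.
- rewrite in_itv /= leey andbT lee_fin mulr_ge0 ?invr_ge0 ?exprn_ge0 ?(ltW s0)//.
  by rewrite -lee_fin -gI integral_ge0// => z _; rewrite lee_fin powR_ge0.
- apply: (@le_trans _ _ (\int[leb R n]_z (g (b + s *: z)%R `^ p)%:E)%E).
    apply: ge0_subset_integral => //; last by move=> z _; rewrite lee_fin powR_ge0.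
    exact: (measurableT_comp mgp (measurable_rV_affine b s)).
  have := ge0_integral_leb_affine b s0 mgp (fun x => ltac:(by rewrite lee_fin powR_ge0)).
  rewrite gI EFinM => <-; rewrite muleA -EFinM mulVf ?mul1e//.
  by rewrite gt_eqF// exprn_gt0.
Qed.

Variables (phi : 'rV[R]_n -> R) (M K p I : R).
Hypotheses (phiC1 : C1 phi) (phiM : forall x, `|phi x| <= M)
  (gradK : forall x, enorm (grad phi x) <= K) (p1 : 1 < p) (np : n%:R < p)
  (gradI : (\int[leb R n]_x (enorm (grad phi x) `^ p)%:E = I%:E)%E).

(* With [w z = v + d z], the derivative of [t |-> \int_Q phi (a + t w)] is at
   most [sup |w|] times an average of [|grad phi|] over a cube of side [t d],
   hence at most [sup |w| * ((t d)^-n I)^(1/p)]. *)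
Lemma morrey_cube (a v : 'rV[R]_n) (d : R) : 0 < d ->
  `|\int[leb R n]_(z in Q) phi (a + (v + d *: z)) - phi a| <=
  (enorm v + d * Num.sqrt n%:R) * (d ^- n * I) `^ p^-1 / (1 - n%:R / p).
Proof.
move=> d0; have p0 : 0 < p by exact: lt_trans ltr01 p1.
have mQ := @measurable_ccube R n 0 1.
have Qfin : (leb R n Q < +oo)%E by rewrite leb_unit_cube ltry.
pose A := enorm v + d * Num.sqrt n%:R.
have A0 : 0 <= A by rewrite addr_ge0 ?enorm_ge0// mulr_ge0 ?sqrtr_ge0// ltW.
pose q (z : 'rV[R]_n) := v + d *: z.
have mq : measurable_fun setT q by exact: measurable_rV_affine.
have qA z : Q z -> enorm (q z) <= A.
  move=> Qz; rewrite (le_trans (ler_enormD _ _))// lerD2l enormZ gtr0_norm//.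
  rewrite ler_wpM2l ?(ltW d0)// -[leRHS]mul1r enorm_le_sqrt// => i.
  by have := Qz i; rewrite mxE add0r => /andP[z0 z1]; rewrite ger0_norm.
pose F s := \int[leb R n]_(z in Q) phi (cst a z + s *: q z).
pose dF t := \int[leb R n]_(z in Q)
  \sum_i q z ord0 i * pderive i phi (cst a z + t *: q z).
have dFE (t : R) : is_derive t (1 : R) F (dF t).
  exact: (is_derive_integral_line phiC1 phiM gradK t mQ Qfin
    (measurable_cst a) mq qA).
have F0 : F 0 = phi a.
  transitivity (\int[leb R n]_(z in Q) phi a).
    by apply: eq_Rintegral => z _; rewrite /cst scale0r addr0.
  by rewrite Rintegral_cst// leb_unit_cube mulr1.
have F1 : F 1 = \int[leb R n]_(z in Q) phi (a + (v + d *: z)).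
  by apply: eq_Rintegral => z _; rewrite scale1r.
rewrite -F0 -F1; apply: (power_growth dFE).
- by rewrite subr_gt0 ltr_pdivrMr// mul1r.
- by rewrite mulr_ge0// powR_ge0.
move=> t t0; have td0 : 0 < t * d by rewrite mulr_gt0.
have cg := continuous_enorm_grad phiC1.
have mint : measurable_fun setT
    (fun z => \sum_i q z ord0 i * pderive i phi (cst a z + t *: q z)).
  apply: measurable_sum => i; apply: measurable_funM.
    apply: (measurableT_comp (measurable_rV_coord i)) => //.
  apply: (measurableT_comp (f := pderive i phi)).
    by apply: continuous_measurable_rV; have [_ _] := phiC1; exact.
  rewrite (_ : (fun z => _) = (fun z => (a + t *: v) + (t * d) *: z)).
    exact: measurable_rV_affine.
  by apply/funext => z; rewrite /q scalerDr scalerA addrA.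
have mg : measurable_fun setT
    (fun z : 'rV[R]_n => enorm (grad phi ((a + t *: v) + (t * d) *: z))).
  exact: (measurableT_comp (continuous_measurable_rV cg)
    (measurable_rV_affine (a + t *: v) (t * d))).
have intle z : Q z ->
    `|\sum_i q z ord0 i * pderive i phi (cst a z + t *: q z)| <=
    A * enorm (grad phi ((a + t *: v) + (t * d) *: z)).
  move=> Qz; rewrite (le_trans (grad_le _ _ _))//.
  rewrite /q scalerDr scalerA addrA ler_wpM2r ?enorm_ge0//; exact: qA.
have inti : (leb R n).-integrable Q (EFin \o
    (fun z => \sum_i q z ord0 i * pderive i phi (cst a z + t *: q z))).
  apply: (@bounded_integrable _ _ _ _ _ _ (A * K)) => //.
    exact: measurable_funTS.
  by move=> z Qz; rewrite (le_trans (intle _ Qz))// ler_wpM2l.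
(* The power [t^(-n/p)] split off from [((t d)^-n I)^(1/p)] is the one that [power_growth] expects
   for [alpha = 1 - n/p], which is positive as [n < p]. *)
have -> : (enorm v + d * Num.sqrt n%:R) * (d ^- n * I) `^ p^-1 *
    t `^ (1 - n%:R / p - 1) = A * ((t * d) ^- n * I) `^ p^-1.
  have I0 : 0 <= I.
    by rewrite -lee_fin -gradI integral_ge0// => z _; rewrite lee_fin powR_ge0.
  rewrite -/A -mulrA; congr (_ * _).
  rewrite exprMn invfM -mulrA [RHS]powRM ?mulr_ge0 ?invr_ge0 ?exprn_ge0 ?(ltW t0) ?(ltW d0)//.
  rewrite mulrC; congr (_ * _).
  rewrite -powR_invn ?(ltW t0)// -powRrM; congr (_ `^ _); ring.
rewrite -lee_fin EFin_normr_Rintegral//.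
apply: (le_trans (le_abse_integral _ _ _)) => //.
  by case/integrableP: inti.
apply: (@le_trans _ _ (\int[leb R n]_(z in Q)
    (A%:E * (enorm (grad phi ((a + t *: v) + (t * d) *: z)))%:E))%E).
  apply: ge0_le_integral => //.
  - by apply: measurableT_comp => //; case/integrableP: inti.
  - apply/measurable_EFinP; apply: measurable_funM => //.
    exact: measurable_funTS.
rewrite ge0_integralZl//; last 2 first.
- apply/measurable_EFinP; exact: measurable_funTS.
- by move=> z _; rewrite lee_fin enorm_ge0.
rewrite EFinM lee_wpmul2l ?lee_fin//.
exact: cube_average_le (fun x => enorm_ge0 _) td0 p1 gradI.
Qed.

(** With [v] half of [y - x], the cubes seen from [x] and from [y] coincide, their corner being the
    midpoint. The common mean cancels, the two halves of [enorm (x - y)] add up, and each end costs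
    [d * Num.sqrt n%:R]. *)
Lemma morrey_bound (x y : 'rV[R]_n) (d : R) : 0 < d -> phi y = 0 ->
  `|phi x| <= (enorm (x - y) + 2 * d * Num.sqrt n%:R) *
    (d ^- n * I) `^ p^-1 / (1 - n%:R / p).
Proof.
move=> d0 y0; pose v := 2^-1 *: (y - x).
have := morrey_cube x v d0; have := morrey_cube y (- v) d0.
have -> : \int[leb R n]_(z in Q) phi (y + (- v + d *: z)) =
  \int[leb R n]_(z in Q) phi (x + (v + d *: z)).
  apply: eq_Rintegral => z _; rewrite !addrA; congr (phi (_ + _)).
  by apply/rowP => i; rewrite !mxE; field.
rewrite y0 subr0 enormN.
have -> : enorm v = enorm (x - y) / 2.
  by rewrite /v enormZ enormB gtr0_norm ?invr_gt0// mulrC.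
move: (\int[_]_(_ in _) _) => J; move: (enorm _) => D.
rewrite -!mulrA; move: (_ `^ _ * _) => C H1 H2.
have -> : phi x = J - (J - phi x) by ring.
rewrite (le_trans (ler_normB _ _))//.
apply: (le_trans (lerD H1 H2)); rewrite le_eqVlt; apply/orP; left; apply/eqP.
by field.
Qed.

End morrey.

(** * Compactly supported functions and integration by parts *)

Lemma bounded_setW {R : realType} {V : normedModType R} (A : set V) :
  bounded_set A -> exists2 M : R, 0 < M & forall x, A x -> `|x| < M.
Proof.
move=> [M [_ MP]]; exists (Num.max 0 M + 2); first by rewrite ltr_wpDl// le_max lexx.
move=> x Ax; apply: (@le_lt_trans _ _ (Num.max 0 M + 1)); last by lra.
by apply: (MP (Num.max 0 M + 1)) => //; rewrite ltr_pwDr// le_max lexx orbT.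
Qed.

Section compact_support.
Context {R : realType} {n : nat}.
Implicit Types (f g : 'rV[R]_n -> R) (K Omega : set 'rV[R]_n).

Lemma compact_support_bounded f K : continuous f -> compact K ->
  (forall x, ~ K x -> f x = 0) -> exists2 M, 0 <= M & forall x, `|f x| <= M.
Proof.
move=> cf cK f0.
have /(continuous_compact (continuous_subspaceT cf))/compact_bounded := cK.
move=> /bounded_setW[M M0 fM]; exists M => [|x]; first exact: ltW.
have [Kx|/f0->] := pselect (K x); last by rewrite normr0 ltW.
by apply/ltW/fM; exists x.
Qed.

Lemma pderive_support f K i : closed K ->
  (forall x, ~ K x -> f x = 0) -> forall x, ~ K x -> pderive i f x = 0.
Proof.
move=> cK f0 x Kx; rewrite /pderive.
rewrite (@near_eq_derive _ _ _ f (cst 0)).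
  by rewrite derive_cst.
have : nbhs x (~` K) by apply: open_nbhs_nbhs; split=> //; exact: closed_openC.
by apply: filterS => y /f0.
Qed.

Lemma compact_support_grad_bounded f K : C1 f -> compact K -> closed K ->
  (forall x, ~ K x -> f x = 0) -> exists L, forall x, enorm (grad f x) <= L.
Proof.
move=> f1 cK clK f0.
have [|L _ gL] := compact_support_bounded (continuous_enorm_grad f1) cK.
  move=> x Kx; rewrite (_ : grad f x = 0) ?enorm0//.
  by apply/rowP => j; rewrite !mxE; exact: pderive_support f0 _ Kx.
by exists L => x; rewrite (le_trans (ler_norm _)).
Qed.

Lemma bounded_ccube K : bounded_set K -> exists2 M : R, 0 < M &
  K `<=` ccube (const_mx (- M)) (2 * M).
Proof.
move=> /bounded_setW[M M0 KM]; exists M => // x Kx i.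
have : `|x ord0 i| <= M.
  apply/ltW/(le_lt_trans _ (KM _ Kx)).
  by rewrite [leRHS]mx_normrE; apply: le_bigmax (ord0, i).
rewrite mxE ler_norml; lra.
Qed.

Lemma bounded_leb_fin K : measurable K -> bounded_set K ->
  (leb R n K < +oo)%E.
Proof.
move=> mK /bounded_ccube[M M0 KM].
apply: (@le_lt_trans _ _ (leb R n (ccube (const_mx (- M)) (2 * M)))).
  by apply: le_measure => //; rewrite inE//; exact: measurable_ccube.
by rewrite leb_ccube ?ltry//; lra.
Qed.

Lemma open_leb_gt0 K x : open K -> K x -> (0 < leb R n K)%E.
Proof.
move=> oK Kx; have /nbhs_ballP[e /= e0 xeK] : nbhs x K by exact: open_nbhs_nbhs.
apply: (@lt_le_trans _ _ (leb R n (ccube x (e / 2)))).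
  by rewrite leb_ccube ?lte_fin ?exprn_gt0//; lra.
apply: le_measure; rewrite ?inE//.
- exact: measurable_ccube.
- exact: open_measurable_rV.
move=> y yQ; apply: xeK; split=> // i j; rewrite ord1.
have := yQ j; rewrite /ball /= => /andP[h1 h2].
by rewrite distrC ger0_norm; lra.
Qed.

(** The affine change of variables concerns nonnegative functions, so the positive and negative
    parts are translated separately. *)
Lemma integral_leb_translate f a : measurable_fun setT f ->
  (\int[leb R n]_z (f (a + z)%R)%:E = \int[leb R n]_z (f z)%:E)%E.
Proof.
move=> mf; have shift (g : 'rV[R]_n -> \bar R) : measurable_fun setT g ->
    (forall x, 0 <= g x)%E ->
    (\int[leb R n]_z g (a + z)%R = \int[leb R n]_z g z)%E.
  move=> mg g0; rewrite -(ge0_integral_leb_affine a ltr01 mg g0) expr1n mul1e.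
  by apply: eq_integral => z _; rewrite scale1r.
rewrite integralE [RHS]integralE; congr (_ - _)%E.
  rewrite -(shift ((fun x => (f x)%:E)^\+)%E)//; first by
    apply: eq_integral => z _; rewrite !(funeposE, funenegE).
  by apply: measurable_funepos; exact/measurable_EFinP.
rewrite -(shift ((fun x => (f x)%:E)^\-)%E)//; first by
  apply: eq_integral => z _; rewrite !(funeposE, funenegE).
by apply: measurable_funeneg; exact/measurable_EFinP.
Qed.

Lemma Rintegral_support f (D E : set 'rV[R]_n) : D `<=` E ->
  (forall x, ~ D x -> f x = 0) ->
  \int[leb R n]_(x in D) f x = \int[leb R n]_(x in E) f x.
Proof.
move=> DE f0; rewrite Rintegral_mkcond [RHS]Rintegral_mkcond.
apply: eq_Rintegral => x _; rewrite !patchE; case: ifPn => [|xD].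
  by rewrite !inE => /DE xE; rewrite mem_set.
by case: ifPn => // _; rewrite f0// => /mem_set; apply/negP.
Qed.

(* The integral of a translate of [f] is constant. *)
Lemma Rintegral_pderive0 f K i : C1 f -> compact K ->
  (forall x, ~ K x -> f x = 0) ->
  \int[leb R n]_x pderive i f x = 0.
Proof.
move=> f1 cK f0; have [cf df cdf] := f1.
have clK : closed K by apply: compact_closed => //; exact: norm_hausdorff.
have [M M0 fM] := compact_support_bounded cf cK f0.
have [L gL] := compact_support_grad_bounded f1 cK clK f0.
have [r r0 Kr] := bounded_setW (compact_bounded cK).
(* [K] lies in the sup-norm ball of radius [r]. The unit of margin keeps its translates by [s e],
   [|s| < 1], inside [B], so integrals over [B] are integrals over the whole space. *)
pose B : set 'rV[R]_n := ccube (const_mx (- (r + 1))) (2 * (r + 1)).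
have inB (x : 'rV[R]_n) : `|x| <= r + 1 -> B x.
  move=> xr j; rewrite mxE.
  have : `|x ord0 j| <= r + 1.
    rewrite (le_trans _ xr)//.
    by rewrite [leRHS]mx_normrE; apply: le_bigmax (ord0, j).
  rewrite ler_norml; lra.
have mB : measurable B by exact: measurable_ccube.
have Bfin : (leb R n B < +oo)%E by rewrite leb_ccube ?ltry//; lra.
pose e : 'rV[R]_n := delta_mx ord0 i.
have e1 : `|e| <= 1.
  rewrite [leLHS]mx_normrE; apply: bigmax_le => // -[j k] _ /=.
  by rewrite mxE; case: (_ && _); rewrite ?normr1 ?normr0.
have := is_derive_integral_line f1 fM gL 0 mB Bfin
  (@measurable_id _ _ setT) (measurable_cst e) (fun z _ => lexx (enorm e)).
set F := (F in is_derive _ _ F _) => dF.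
have Fconst (s : R) : `|s| < 1 -> F s = F 0.
  move=> s1; have FE (s' : R) : `|s'| < 1 ->
      F s' = \int[leb R n]_z f (s' *: e + z).
    move=> s'1; rewrite /F; under eq_Rintegral do rewrite addrC.
    apply: Rintegral_support => // z Bz; apply: f0 => /Kr zr; apply: Bz.
    apply: inB; have -> : z = (s' *: e + z) - s' *: e by rewrite addrC addKr.
    rewrite (le_trans (ler_normB _ _))// lerD ?(ltW zr)// normrZ.
    by rewrite mulr_ile1// ltW.
  rewrite !FE ?normr0//; congr fine.
  have mf := continuous_measurable_rV cf.
  by rewrite !integral_leb_translate.
have dF0 : is_derive (0 : R) (1 : R) F 0.
  apply: (@near_eq_is_derive _ _ _ (cst (F 0)) _ _ _ _ _ (is_derive_cst _ _ _)).
  apply/nbhs_ballP; exists 1 => //= s; rewrite /ball /= sub0r normrN => s1.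
  by rewrite Fconst.
have := @derive_val _ _ _ _ _ _ _ dF; rewrite (@derive_val _ _ _ _ _ _ _ dF0).
have -> : \int[leb R n]_x pderive i f x = \int[leb R n]_(x in B) pderive i f x.
  apply/esym/Rintegral_support => // z Bz; apply: (pderive_support i clK f0).
  by move=> /Kr zr; apply/Bz/inB; lra.
move=> ->; apply: eq_Rintegral => z _.
rewrite (bigD1 i)//= mxE !eqxx mul1r big1 ?addr0 ?scale0r ?addr0// => j ji.
by rewrite mxE (negbTE ji) andbF mul0r.
Qed.

End compact_support.

Section test_functions.
Context {R : realType} {n : nat}.
Implicit Types (u phi : 'rV[R]_n -> R) (Omega : set 'rV[R]_n).

Lemma test_function_support Omega phi : test_function Omega phi ->
  exists K, [/\ compact K, closed K, K `<=` Omega &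
    forall x, ~ K x -> phi x = 0].
Proof.
move=> [_ cK KO]; exists (closure [set x | phi x != 0]); split=> //.
  exact: closed_closure.
move=> x; have [->//|phix0] := eqVneq (phi x) 0.
by case; exact: subset_closure.
Qed.

Lemma C1M u phi : C1 u -> C1 phi -> C1 (u * phi).
Proof.
move=> [cu du cdu] [cp dp cdp]; split=> [x|i x|i].
- exact: (cvgM (cu x) (cp x)).
- exact: derivableM.
- rewrite (_ : pderive i _ =
      (fun x => u x * pderive i phi x + phi x * pderive i u x)).
    move=> x; exact: (cvgD (cvgM (cu x) (cdp i x)) (cvgM (cp x) (cdu i x))).
  by apply/funext => x; rewrite /pderive deriveM.
Qed.

(** [u * phi] is C^1 with compact support, so its partial derivative has integral 0. Both terms of
    the product rule are bounded on a set of finite measure, which allows the integral to be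
    split. *)
Lemma integration_by_parts Omega u phi (i : 'I_n) :
  open Omega -> bounded_set Omega ->
  test_function Omega u -> test_function Omega phi ->
  \int[leb R n]_(x in Omega) (u x * pderive i phi x) =
  - \int[leb R n]_(x in Omega) (pderive i u x * phi x).
Proof.
move=> oO bO tu tphi.
have [/smooth_C1 u1 _ _] := tu; have [/smooth_C1 p1 _ _] := tphi.
have [cu du cdu] := u1; have [cp dp cdp] := p1.
have mO := open_measurable_rV oO.
have Ofin := bounded_leb_fin mO bO.
have [K [cK clK KO u0]] := test_function_support tu.
have du0 := pderive_support i clK u0.
have int1 : (leb R n).-integrable Omega
    (EFin \o (fun x => u x * pderive i phi x)).
  have cf : continuous (fun x => u x * pderive i phi x).
    by move=> x; exact: (cvgM (cu x) (cdp i x)).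
  have [|M _ fM] := compact_support_bounded cf cK.
    by move=> x /u0 ->; rewrite mul0r.
  apply: (@bounded_integrable _ _ _ _ _ _ M) => //.
  by apply: measurable_funTS; exact: continuous_measurable_rV.
have int2 : (leb R n).-integrable Omega
    (EFin \o (fun x => pderive i u x * phi x)).
  have cf : continuous (fun x => pderive i u x * phi x).
    by move=> x; exact: (cvgM (cdu i x) (cp x)).
  have [|M _ fM] := compact_support_bounded cf cK.
    by move=> x /du0 ->; rewrite mul0r.
  apply: (@bounded_integrable _ _ _ _ _ _ M) => //.
  by apply: measurable_funTS; exact: continuous_measurable_rV.
apply/eqP; rewrite -addr_eq0 -RintegralD//; apply/eqP.
have up0 x : ~ K x -> (u * phi) x = 0 by move=> /u0 E; rewrite /= /GRing.mul /= E mul0r.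
rewrite -[RHS](Rintegral_pderive0 i (C1M u1 p1) cK up0).
rewrite (@Rintegral_support _ _ _ Omega setT)//; last first.
  by move=> x Ox; rewrite u0 ?du0 ?mul0r ?addr0// => /KO.
apply: eq_Rintegral => x _; rewrite /pderive deriveM//.
by rewrite (mulrC _ (phi x)).
Qed.

End test_functions.

(** * Essential suprema of continuous functions *)

Section essential_supremum.
Context {R : realType} {n : nat}.
Implicit Types (f : 'rV[R]_n -> R) (Omega : set 'rV[R]_n).

(** The norm with exponent [+oo] unfolds to an essential supremum under the condition that the whole
    space has positive measure; a nonempty open set provides it. *)
Lemma Ls_normyE Omega f : open Omega -> Omega !=set0 ->
  Ls_norm Omega +oo f = ess_sup (leb R n) (abse \o ((EFin \o f) \_ Omega)).
Proof.
move=> oO [x Ox]; rewrite /Ls_norm Lnorm.unlock ifT//.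
apply: (lt_le_trans (open_leb_gt0 oO Ox)).
by apply: le_measure; rewrite ?inE//; exact: open_measurable_rV.
Qed.

(** By continuity the part of [Omega] where [f > r - e] is open; being nonempty, it has positive
    measure, so no smaller essential bound exists. Both the distance function and the bump are
    treated this way. *)
Lemma Ls_normy_sup Omega f (r : R) : open Omega -> continuous f ->
  (forall x, Omega x -> `|f x| <= r) ->
  (forall e, 0 < e -> exists2 x, Omega x & r - e < f x) ->
  Ls_norm Omega +oo f = r%:E.
Proof.
move=> oO cf fr rf.
have [x0 Ox0 _] := rf 1 ltr01.
rewrite Ls_normyE//; last by exists x0.
have r0 : 0 <= r by rewrite (le_trans _ (fr _ Ox0)).
apply/eqP; rewrite eq_le; apply/andP; split.
  apply/ess_supP; apply: nearW => x /=; rewrite patchE.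
  by case: ifPn => [|_]; rewrite ?abse0 ?lee_fin// inE => Ox; exact: fr.
apply/lee_addgt0Pr => e e0; rewrite leNgt; apply/negP => lt_re.
have [x Ox rx] := rf _ e0.
pose U := Omega `&` f @^-1` [set t | r - e < t].
have oU : open U by apply: openI => //; move/continuousP: cf; apply; exact: open_gt.
have Ux : U x by [].
have : (leb R n).-negligible U.
  have := ess_sup_ge (leb R n) (abse \o ((EFin \o f) \_ Omega)).
  apply: negligibleS => y [Oy yr] /=; apply/negP; rewrite -ltNge patchE mem_set//=.
  rewrite -lteBrDr// in lt_re; apply: (lt_le_trans lt_re).
  by rewrite -EFinB lee_fin (le_trans (ltW yr))// ler_norm.
move/(negligibleP _ (open_measurable_rV oU)) => U0.
by have := open_leb_gt0 oU Ux; rewrite U0 ltxx.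
Qed.

End essential_supremum.

(** * Distance to the boundary and inradius *)

Section boundary_distance.
Context {R : realType} {n : nat}.
Variable Omega : set 'rV[R]_n.
Hypothesis oO : open Omega.
Local Notation bd := (closure Omega `\` Omega°).

Lemma boundary_notin y : bd y -> ~ Omega y.
Proof. by move=> [_]; move/interior_id: oO => ->. Qed.

(* The boundary point is reached at the infimum of the parameters at which the
   segment is outside Omega. *)
Lemma segment_boundary x z : Omega x -> ~ Omega z ->
  exists2 y, bd y & enorm (y - x) <= enorm (z - x).
Proof.
move=> Ox Oz; pose g (s : R) := x + s *: (z - x).
have cg : continuous g.
  move=> s; apply: cvgD; first exact: cvg_cst.
  by apply: cvgZr_tmp => //; exact: cvg_id.
pose T := [set t : R | 0 <= t /\ ~ Omega (g t)].
have T1 : T 1 by split=> //; rewrite /g scale1r addrC subrK.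
have lT : has_lbound T by exists 0 => t [].
have iT : has_inf T by split=> //; exists 1.
pose t := inf T.
have t0 : 0 <= t by apply: lb_le_inf => [|s []//]; exists 1.
have t1 : t <= 1 by exact: ge_inf.
have gO s : 0 <= s < t -> Omega (g s).
  move=> /andP[s0 st]; apply: contrapT => gs.
  by have := ge_inf lT (conj s0 gs : T s); rewrite leNgt st.
have Ogt : ~ Omega (g t).
  move=> Ogt; have : \forall s \near t, Omega (g s).
    by apply: cg; exact: open_nbhs_nbhs.
  move=> /nbhs_ballP[e /= e0 eP].
  have [s [s0 gs] st] := inf_adherent e0 iT.
  have ts : t <= s by exact: ge_inf.
  apply: gs; apply: eP; rewrite /ball /= distrC ger0_norm; first by rewrite -/t in st; lra.
  by rewrite subr_ge0.
exists (g t); last first.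
  rewrite /g addrC addKr enormZ ger0_norm//.
  by rewrite ler_piMl// enorm_ge0.
split; last by move/interior_id: oO => ->.
(* Since [g 0 = x] is in [Omega], the infimum is positive, and the points slightly before it, all in
   [Omega], approach [g t]. *)
have tpos : 0 < t.
  rewrite lt_neqAle t0 andbT; apply/eqP => t_0; apply: Ogt.
  by rewrite -t_0 /g scale0r addr0.
move=> B /cg /nbhs_ballP[e /= e0 eP].
pose s := Num.max 0 (t - e / 2).
exists (g s); split.
  by apply: gO; rewrite le_max lexx /= gt_max tpos; lra.
apply: eP; rewrite /ball /= ger0_norm /s.
  by rewrite ltrBlDr -ltrBlDl lt_max; apply/orP; right; lra.
by rewrite subr_ge0 ge_max t0; lra.
Qed.

Lemma bdist_le x y : bd y -> bdist Omega x <= enorm (y - x).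
Proof.
by move=> by_; apply: ge_inf; [exists 0 => _ [z _ <-]; exact: enorm_ge0|exists y].
Qed.

(** Otherwise the segment from [x] to [z] would meet the boundary closer to [x] than
    [bdist Omega x]. *)
Lemma bdist_ball x z : Omega x -> enorm (z - x) < bdist Omega x -> Omega z.
Proof.
move=> Ox zx; apply: contrapT => Oz.
have [y by_ yz] := segment_boundary Ox Oz.
by have := le_lt_trans (le_trans (bdist_le x by_) yz) zx; rewrite ltxx.
Qed.

Hypothesis bd0 : bd !=set0.

Let has_inf_bdist x : has_inf [set enorm (y - x) | y in bd].
Proof.
split; first by have [y yb] := bd0; exists (enorm (y - x)), y.
by exists 0 => _ [z _ <-]; exact: enorm_ge0.
Qed.

Lemma bdist_adherent x e : 0 < e ->
  exists2 y, bd y & enorm (y - x) < bdist Omega x + e.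
Proof.
by move=> e0; have [_ [y yb <-] ye] := inf_adherent e0 (has_inf_bdist x); exists y.
Qed.

Lemma bdist_lipschitz x z : `|bdist Omega x - bdist Omega z| <= enorm (x - z).
Proof.
have le a b : bdist Omega a <= bdist Omega b + enorm (a - b).
  apply/ler_addgt0Pr => e e0; have [y yb ye] := bdist_adherent b e0.
  rewrite (le_trans (bdist_le a yb))//.
  have -> : y - a = (y - b) + (b - a) by rewrite addrA subrK.
  by rewrite (le_trans (ler_enormD _ _))// (enormB b a); lra.
have := le x z; have := le z x; rewrite (enormB z) ler_norml => h1 h2.
by apply/andP; split; lra.
Qed.

Lemma continuous_bdist : continuous (bdist Omega).
Proof. exact: lipschitz_enorm_continuous bdist_lipschitz. Qed.

Lemma bdist_gt0 x : Omega x -> 0 < bdist Omega x.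
Proof.
move=> Ox; have /nbhs_ballP[e /= e0 eO] : nbhs x Omega by exact: open_nbhs_nbhs.
apply: (lt_le_trans e0); apply: lb_le_inf.
  by have [] := has_inf_bdist x.
move=> _ [y yb <-]; rewrite leNgt; apply/negP => ye.
apply: (boundary_notin yb); apply: eO; rewrite -ball_normE /= distrC.
exact: le_lt_trans (norm_le_enorm _) ye.
Qed.

End boundary_distance.

Section bounded_domain.
Context {R : realType} {n : nat}.
Variable Omega : set 'rV[R]_n.
Hypotheses (n0 : (0 < n)%N) (oO : open Omega) (O0 : Omega !=set0)
  (bO : bounded_set Omega).

Lemma boundary_nonempty : (closure Omega `\` Omega°) !=set0.
Proof.
have [x Ox] := O0; have [M M0 OM] := bounded_setW bO.
(* [const_mx M] has sup norm [M] as soon as there is a coordinate, whence [0 < n]. *)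
have Oz : ~ Omega (const_mx M).
  move=> /OM; apply/negP; rewrite -leNgt [leRHS]mx_normrE.
  rewrite (le_trans (ler_norm M))//.
  have := @le_bigmax _ _ _ 0 (fun ij : 'I_1 * 'I_n =>
    `|(const_mx M : 'rV[R]_n) ij.1 ij.2|) (ord0, Ordinal n0).
  by rewrite mxE.
by have [y yb _] := segment_boundary oO Ox Oz; exists y.
Qed.

(** A Lipschitz function is bounded on a bounded set, and by continuity its supremum is also the
    essential one. The near-maximisers will be the centres of the bumps. *)
Lemma inradius : exists r : R, [/\ 0 < r,
  Ls_norm Omega +oo (bdist Omega) = r%:E,
  forall x, Omega x -> bdist Omega x <= r
  & forall e, 0 < e -> exists2 x, Omega x & r - e < bdist Omega x].
Proof.
have bd0 := boundary_nonempty; have [x0 Ox0] := O0.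
pose E := bdist Omega @` Omega.
have supE : has_sup E.
  split; first by exists (bdist Omega x0), x0.
  have [M M0 OM] := bounded_setW bO.
  exists (bdist Omega x0 + 2 * M * Num.sqrt n%:R) => _ [x Ox <-].
  have := bdist_lipschitz bd0 x x0; rewrite ler_norml => /andP[_].
  have := enorm_le_norm (x - x0).
  have : `|x - x0| * Num.sqrt n%:R <= 2 * M * Num.sqrt n%:R.
    rewrite ler_wpM2r ?sqrtr_ge0// (le_trans (ler_normB _ _))//.
    by have := OM _ Ox; have := OM _ Ox0; lra.
  lra.
have ub x : Omega x -> bdist Omega x <= sup E.
  by move=> Ox; apply: sup_upper_bound => //; exists x.
have adh e : 0 < e -> exists2 x, Omega x & sup E - e < bdist Omega x.
  by move=> e0; have [_ [x Ox <-] xe] := sup_adherent e0 supE; exists x.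
exists (sup E); split=> //.
  by apply: (lt_le_trans (bdist_gt0 oO bd0 Ox0)); exact: ub.
apply: Ls_normy_sup => //; first exact: continuous_bdist.
move=> x Ox; rewrite ger0_norm ?ub// ltW//; exact: bdist_gt0.
Qed.

End bounded_domain.

(** * Flat cutoffs and explicit smooth functions *)

Section cutoff.
Context {R : realType}.
Variable eta : R.
Hypothesis eta0 : 0 < eta.

(** The powers of [1 / t] close the family under differentiation: the derivative of member [k]
    combines members [k + 2] and [k + 1]. A small [eta] brings [t * cutoff eta 0 t] close to the
    positive part of [t]. *)
Definition cutoff (k : nat) (t : R) : R :=
  if 0 < t then expR (- (eta / t)) * t^-1 ^+ k else 0.

Lemma cutoff_ge0 k t : 0 <= cutoff k t.
Proof.
rewrite /cutoff; case: ifPn => // t0.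
by rewrite mulr_ge0 ?expR_ge0// exprn_ge0// invr_ge0 ltW.
Qed.

(** [exp y >= y^(k+2) / (k+2)!] with [y = eta / t]: the exponent [k + 2] leaves [t^2] after
    multiplication by [t^-k], enough for a zero derivative at 0. *)
Lemma cutoff_le k t : 0 < t ->
  cutoff k t <= (k.+2)`!%:R / eta ^+ k.+2 * t ^+ 2.
Proof.
move=> t0; rewrite /cutoff t0 expRN.
have y0 : 0 < eta / t by rewrite divr_gt0.
have f0 : 0 < (k.+2)`!%:R :> R by rewrite ltr0n fact_gt0.
have P : (eta / t) ^+ k.+2 / (k.+2)`!%:R <= expR (eta / t).
  by have := expR_ge1Dxn k.+1 (ltW y0); lra.
have P0 : 0 < (eta / t) ^+ k.+2 / (k.+2)`!%:R by rewrite divr_gt0// exprn_gt0.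
have := P; rewrite -lef_pV2 ?posrE ?expR_gt0// => /(ler_wpM2r
  (exprn_ge0 k (ltW (divr_gt0 ltr01 t0)))); rewrite div1r => /le_trans; apply.
rewrite le_eqVlt; apply/orP; left; apply/eqP.
rewrite invf_div expr_div_n !exprS !exprVn; field.
by rewrite !expf_neq0 ?gt_eqF.
Qed.

Lemma is_derive_cutoff k (t : R) : is_derive t (1 : R) (cutoff k)
  (eta * cutoff k.+2 t - k%:R * cutoff k.+1 t).
Proof.
have [t0|t0|t0] := ltrgt0P t.
- have tN0 : t != 0 by rewrite gt_eqF.
  apply: (@near_eq_is_derive _ _ _
      ((expR \o (- eta \*: (fun s : R => s^-1))) * ((fun s : R => s^-1) ^+ k))).
    have : \forall s \near t, 0 < s by exact: lt_nbhsr.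
    apply: filterS => s s0; rewrite /cutoff s0 /GRing.mul /= /GRing.scale /=.
    by rewrite mulNr exprfctE.
  have di : is_derive t (1 : R) (fun s : R => s^-1) (- (t^-1 ^+ 2)).
    have := @is_deriveV R id t 1 1 tN0 (is_derive_id _ _).
    by rewrite /GRing.scale /= mulr1 exprVn.
  have de := @is_derive1_comp _ expR (- eta \*: (fun s : R => s^-1)) t _ _
    (is_derive_expR _) (is_deriveZ (- eta) di).
  apply: (@is_derive_eq _ _ _ _ _ _ _ _ (is_deriveM de (is_deriveX k di))).
  rewrite /cutoff t0 /= /GRing.scale /= exprfctE mulNr.
  case: k => [|k]; first by rewrite !expr0 mul0r; ring.
  by rewrite succnK !exprS; ring.
- have [r r0] : exists2 r, 0 < r & forall s, `|t - s| < r -> s < 0.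
    by exists (- t) => [|s]; rewrite ?oppr_gt0// ltr_norml; lra.
  move=> rP; rewrite /cutoff ltNge (ltW t0) /= !mulr0 subrr.
  apply: (@near_eq_is_derive _ _ _ (cst 0)).
  by apply/nbhs_ballP; exists r => // s /rP s0; rewrite /= ltNge (ltW s0).
(* At 0 the quadratic bound [C h^2] is at most [e * |h|] once [|h| < e / (C + 1)]. *)
- rewrite t0 {2 3}/cutoff ltxx !mulr0 subrr.
  apply/is_derive_epsP => e e0.
  pose C := (k.+2)`!%:R / eta ^+ k.+2.
  have C0 : 0 <= C by rewrite divr_ge0// exprn_ge0// ltW.
  exists (e / (C + 1)); first by rewrite divr_gt0// ltr_wpDl.
  move=> h; rewrite ltr_pdivlMr ?ltr_wpDl// => hr.
  rewrite {2}/cutoff ltxx subr0 mulr0 subr0 add0r.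
  rewrite (_ : h *: 1 = h); last exact: mulr1.
  rewrite ger0_norm ?cutoff_ge0//; have [h0|h0] := ltP 0 h; last first.
    by rewrite /cutoff ltNge h0 /= mulr_ge0// ltW.
  rewrite (le_trans (cutoff_le k h0))// -/C.
  rewrite (gtr0_norm h0) in hr *; rewrite expr2 mulrA ler_wpM2r ?(ltW h0)//.
  by apply/ltW/(le_lt_trans _ hr); rewrite mulrC ler_wpM2l ?(ltW h0)// lerDl.
Qed.

End cutoff.

Section bump.
Context {R : realType} {n : nat}.
Variables (x0 : 'rV[R]_n) (r delta eta : R).
Hypotheses (delta0 : 0 < delta) (eta0 : 0 < eta) (deltar : delta < r).

(* A smooth approximation of |x - x0|. *)
Definition soft_norm (x : 'rV[R]_n) : R :=
  Num.sqrt (delta ^+ 2 + \sum_i (x ord0 i - x0 ord0 i) ^+ 2).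

Let q (x : 'rV[R]_n) : R := delta ^+ 2 + \sum_i (x ord0 i - x0 ord0 i) ^+ 2.

Let qE x : q x = delta ^+ 2 + enorm (x - x0) ^+ 2.
Proof. by rewrite sqr_enorm; congr (_ + _); apply: eq_bigr => i _; rewrite !mxE. Qed.

Let q_gt0 x : 0 < q x.
Proof. by rewrite qE ltr_wpDr ?sqr_ge0// exprn_gt0. Qed.

Lemma sqr_soft_norm x : soft_norm x ^+ 2 = delta ^+ 2 + enorm (x - x0) ^+ 2.
Proof. by rewrite -qE; exact/sqr_sqrtr/ltW/q_gt0. Qed.

Lemma soft_norm_gt0 x : 0 < soft_norm x.
Proof. by rewrite sqrtr_gt0; exact: q_gt0. Qed.

Lemma delta_le_soft_norm x : delta <= soft_norm x.
Proof.
rewrite -(@ler_pXn2r _ 2) ?nnegrE ?(ltW delta0) ?(ltW (soft_norm_gt0 x))//.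
by rewrite sqr_soft_norm lerDl sqr_ge0.
Qed.

Lemma soft_norm0 : soft_norm x0 = delta.
Proof.
apply/eqP; rewrite -(@eqrXn2 _ 2) ?(ltW delta0) ?(ltW (soft_norm_gt0 x0))//.
by rewrite sqr_soft_norm subrr enorm0 expr0n addr0.
Qed.

Lemma enorm_le_soft_norm x : enorm (x - x0) <= soft_norm x.
Proof.
rewrite -(@ler_pXn2r _ 2) ?nnegrE ?enorm_ge0 ?(ltW (soft_norm_gt0 x))//.
by rewrite sqr_soft_norm lerDr sqr_ge0.
Qed.

Lemma is_derive_soft_norm x i : is_derive x (delta_mx ord0 i) soft_norm
  ((x ord0 i - x0 ord0 i) / soft_norm x).
Proof.
have dq : is_derive x (delta_mx ord0 i) q (2 * (x ord0 i - x0 ord0 i)).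
  apply/is_derive_epsP => e e0; exists e => // h he.
  suff -> : q (x + h *: delta_mx ord0 i) - q x -
      h * (2 * (x ord0 i - x0 ord0 i)) = h * h.
    by rewrite normrM ler_wpM2r// ltW.
  rewrite /q (bigD1 i)//= [in X in _ - X - _](bigD1 i)//= !mxE !eqxx.
  rewrite [in X in _ - X - _](eq_bigr (fun j =>
    ((x + h *: delta_mx ord0 i) ord0 j - x0 ord0 j) ^+ 2)); first by rewrite /=; ring.
  by move=> j ji; rewrite !mxE (negbTE ji) andbF mulr0 addr0.
have := is_derive_comp (is_derive1_sqrt (q_gt0 x)) dq.
congr (is_derive _ _ _ _); rewrite /soft_norm -/(q x); field.
by rewrite gt_eqF// sqrtr_gt0.
Qed.

(** A class of expressions stable under partial derivatives: each generator has its derivatives in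
    the class, and sums and products preserve this. Smoothness then follows by induction on the word
    of indices. *)
Inductive radial : ('rV[R]_n -> R) -> Prop :=
| radial_cst c : radial (fun=> c)
| radial_coord i : radial (fun x => x ord0 i)
| radial_norm : radial soft_norm
| radial_inv : radial (fun x => (soft_norm x)^-1)
| radial_cutoff k : radial (fun x => cutoff eta k (r - soft_norm x))
| radialD f g : radial f -> radial g -> radial (fun x => f x + g x)
| radialM f g : radial f -> radial g -> radial (fun x => f x * g x).

Lemma is_derive_radial f i : radial f -> exists2 g, radial g &
  forall x, is_derive x (delta_mx ord0 i) f (g x).
Proof.
have rN f' : radial f' -> radial (fun x => - f' x).
  move=> rf; rewrite (_ : (fun _ => _) = (fun x => -1 * f' x)).
    exact: radialM (radial_cst _) rf.
  by apply/funext => x; rewrite mulN1r.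
have rdw : radial (fun x => (x ord0 i - x0 ord0 i) / soft_norm x).
  exact: radialM (radialD (radial_coord i) (radial_cst _)) radial_inv.
elim=> [c|j|||k|f1 f2 _ [g1 rg1 d1] _ [g2 rg2 d2]|
        f1 f2 rf1 [g1 rg1 d1] rf2 [g2 rg2 d2]].
- by exists (fun=> 0) => [|x]; [exact: radial_cst|exact: is_derive_cst].
- exists (fun=> (i == j)%:R) => [|x]; first exact: radial_cst.
  apply/is_derive_epsP => e e0; exists 1 => // h _.
  rewrite !mxE eqxx /= (eq_sym j) [_ + h * _]addrC addrK subrr normr0.
  by rewrite mulr_ge0// ltW.
- exists (fun x : 'rV[R]_n => (x ord0 i - x0 ord0 i) / soft_norm x) => // x.
  exact: is_derive_soft_norm.
- exists (fun x => - ((soft_norm x)^-1 * (soft_norm x)^-1) *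
      ((x ord0 i - x0 ord0 i) / soft_norm x)) => [|x].
    by apply: radialM => //; apply: rN; apply: radialM; exact: radial_inv.
  apply: (@is_derive_comp _ _ (fun t => t^-1)); last exact: is_derive_soft_norm.
  have w0 : soft_norm x != 0 by rewrite gt_eqF// soft_norm_gt0.
  have := @is_deriveV R id (soft_norm x) 1 1 w0 (is_derive_id _ _).
  by rewrite /GRing.scale /= mulr1 -exprVn expr2.
- exists (fun x => (eta * cutoff eta k.+2 (r - soft_norm x) -
    k%:R * cutoff eta k.+1 (r - soft_norm x)) *
    - ((x ord0 i - x0 ord0 i) / soft_norm x)) => [|x].
    apply: radialM; last exact: rN.
    apply: radialD; last apply: rN.
      exact: radialM (radial_cst _) (radial_cutoff _).
    exact: radialM (radial_cst _) (radial_cutoff _).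
  apply: (@is_derive_comp _ _ (cutoff eta k) (fun x => r - soft_norm x)).
    exact: is_derive_cutoff.
  rewrite -[X in is_derive _ _ _ X]sub0r.
  exact: (is_deriveB (is_derive_cst _ _ _) (is_derive_soft_norm x i)).
- exists (fun x => g1 x + g2 x) => [|x]; first exact: radialD.
  exact: is_deriveD (d1 x) (d2 x).
- exists (fun x => f1 x * g2 x + f2 x * g1 x) => [|x].
    by apply: radialD; exact: radialM.
  exact: is_deriveM (d1 x) (d2 x).
Qed.

Lemma continuous_soft_norm : continuous soft_norm.
Proof.
have cq : continuous (fun x : 'rV[R]_n => delta ^+ 2 + enorm (x - x0) ^+ 2).
  have ce := @continuous_enormB R n x0.
  by move=> x; exact: (cvgD (cvg_cst (delta ^+ 2)) (cvgM (ce x) (ce x))).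
rewrite (_ : soft_norm = Num.sqrt \o
    (fun x : 'rV[R]_n => delta ^+ 2 + enorm (x - x0) ^+ 2)).
  by move=> x; apply: continuous_comp; [exact: cq|exact: sqrt_continuous].
by apply/funext => x /=; rewrite -qE.
Qed.

Lemma continuous_radial f : radial f -> continuous f.
Proof.
elim=> [c|j|||k|f1 f2 _ c1 _ c2|f1 f2 _ c1 _ c2] x.
- exact: (cvg_cst (F := nbhs x) c).
- exact: coord_continuous.
- exact: continuous_soft_norm.
- have w0 : soft_norm x != 0 by rewrite gt_eqF// soft_norm_gt0.
  exact: (cvgV w0 (@continuous_soft_norm x)).
- apply: (@continuous_comp _ _ _ (fun x => r - soft_norm x) (cutoff eta k)).
    exact: (cvgB (cvg_cst r) (@continuous_soft_norm x)).
  exact: is_derive1_continuous (is_derive_cutoff eta0 _ _).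
- exact: (cvgD (c1 x) (c2 x)).
- exact: (cvgM (c1 x) (c2 x)).
Qed.

Lemma smooth_radial f : radial f -> smooth f.
Proof.
move=> rf s; have rs : radial (foldr (@pderive R n) f s).
  elim: s => //= i s IH; have [g rg dg] := is_derive_radial i IH.
  rewrite (_ : pderive i _ = g)//; apply/funext => x.
  exact: (@derive_val _ _ _ _ _ _ _ (dg x)).
split=> [|i x]; first exact: continuous_radial.
have [g _ dg] := is_derive_radial i rs.
exact: (@ex_derive _ _ _ _ _ _ _ (dg x)).
Qed.

End bump.

(** * Norms of L^s and competitors for Lambda_p *)

Section Ls_norms.
Context {R : realType} {n : nat}.
Implicit Types (f : 'rV[R]_n -> R) (Omega : set 'rV[R]_n) (p : R).

Lemma powR_Ls_norm Omega p f : 0 < p ->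
  (Ls_norm Omega p%:E f `^ p =
   \int[leb R n]_(x in Omega) (`|f x| `^ p)%:E)%E.
Proof.
move=> p0; rewrite /Ls_norm powR_Lnorm ?gt_eqF//.
rewrite [RHS]integral_mkcond; apply: eq_integral => x _ /=.
rewrite !patchE; case: (x \in Omega) => //=.
by rewrite normr0 powR0// gt_eqF.
Qed.

Lemma Ls_normE Omega p f : 0 < p -> Ls_norm Omega p%:E f =
  ((\int[leb R n]_(x in Omega) (`|f x| `^ p)%:E) `^ p^-1)%E.
Proof.
move=> p0; rewrite -powR_Ls_norm// -poweRrM divff ?gt_eqF// poweRe1//.
exact: Lnorm_ge0.
Qed.

Lemma integral_powR_le Omega p f (M : R) : 0 < p ->
  measurable Omega -> measurable_fun Omega f ->
  (forall x, Omega x -> `|f x| <= M) ->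
  (\int[leb R n]_(x in Omega) (`|f x| `^ p)%:E <=
   (M `^ p)%:E * leb R n Omega)%E.
Proof.
move=> p0 mO mf fM; rewrite -integral_cst//; apply: ge0_le_integral => //.
- apply/measurable_EFinP; apply: (@measurableT_comp _ _ _ _ _ _ (@powR R ^~ p)).
    exact: measurable_powR.
  exact: measurableT_comp.
- move=> x Ox; rewrite lee_fin ge0_ler_powR ?(ltW p0)//.
  + by rewrite nnegrE (le_trans _ (fM _ Ox)).
  + exact: fM.
Qed.

Lemma bounded_in_Ls Omega p f (M : R) : 0 < p ->
  measurable Omega -> (leb R n Omega < +oo)%E -> measurable_fun Omega f ->
  (forall x, Omega x -> `|f x| <= M) -> in_Ls Omega p%:E f.
Proof.
move=> p0 mO Ofin mf fM; split=> //; rewrite Ls_normE//.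
apply: poweR_lty; apply: (le_lt_trans (integral_powR_le p0 mO mf fM)).
by rewrite lte_mul_pinfty// lee_fin powR_ge0.
Qed.

Lemma test_function_bounded Omega f : test_function Omega f ->
  exists2 M, (forall x, `|f x| <= M) & (forall x, enorm (grad f x) <= M).
Proof.
move=> tf; have [/smooth_C1 f1 _ _] := tf; have [cf df cdf] := f1.
have [K [cK clK KO f0]] := test_function_support tf.
have [M M0 fM] := compact_support_bounded cf cK f0.
have [L gL] := compact_support_grad_bounded f1 cK clK f0.
by exists (Num.max M L) => x; rewrite le_max ?fM ?gL ?orbT.
Qed.

(** Integration by parts makes the classical gradient a weak one, and [f] is its own approximation
    by test functions. *)
Lemma test_function_W01p Omega p f : 0 < p -> open Omega ->
  bounded_set Omega -> test_function Omega f -> W01p Omega p f (grad f).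
Proof.
move=> p0 oO bO tf; have [/smooth_C1 f1 _ _] := tf; have [cf df cdf] := f1.
have mO := open_measurable_rV oO; have Ofin := bounded_leb_fin mO bO.
have [M fM gM] := test_function_bounded tf.
split; first split.
- apply: (@bounded_in_Ls _ _ _ M) => //.
  by apply: measurable_funTS; exact: continuous_measurable_rV.
- move=> i; apply: (@bounded_in_Ls _ _ _ M) => //.
    apply: measurable_funTS; rewrite (_ : (fun _ => _) = pderive i f).
      exact: continuous_measurable_rV.
    by apply/funext => x; rewrite mxE.
  by move=> x _; rewrite (le_trans (coord_le_enorm _ _)).
- move=> i phi tphi; rewrite integration_by_parts//; congr (- _).
  by apply: eq_Rintegral => x _; rewrite mxE.
- move=> e e0; exists f => //; rewrite /W1p_norm.
  have Ls0 : Ls_norm Omega p%:E (fun=> 0) = 0%E.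
    rewrite Ls_normE// integral0_eq ?poweR0r ?gt_eqF ?invr_gt0// => x _.
    by rewrite normr0 powR0// gt_eqF.
  rewrite (_ : (fun x => f x - f x) = fun=> 0); last first.
    by apply/funext => x; rewrite subrr.
  rewrite (_ : (fun x => enorm _) = fun=> 0); last first.
    by apply/funext => x; rewrite subrr enorm0.
  by rewrite Ls0 adde0 lte_fin.
Qed.

Lemma measurable_enorm_grad Omega f : C1 f ->
  measurable_fun Omega (fun x => enorm (grad f x)).
Proof.
move=> f1; apply: measurable_funTS.
by apply: continuous_measurable_rV; exact: continuous_enorm_grad.
Qed.

Lemma Lambda_le Omega p f (M : R) : 0 < p -> open Omega ->
  bounded_set Omega -> test_function Omega f ->
  Ls_norm Omega +oo f = 1%E -> (forall x, enorm (grad f x) <= M) ->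
  (Lambda Omega p <= (M `^ p)%:E * leb R n Omega)%E.
Proof.
move=> p0 oO bO tf f1 gM; have [/smooth_C1 fC1 _ _] := tf.
have mO := open_measurable_rV oO.
apply: (@le_trans _ _ (Ls_norm Omega p%:E (fun x => enorm (grad f x)) `^ p)%E).
  apply: ereal_inf_lbound; exists f, (grad f); split=> //.
  exact: test_function_W01p.
rewrite powR_Ls_norm//; apply: integral_powR_le => //.
  exact: measurable_enorm_grad.
by move=> x _; rewrite ger0_norm ?enorm_ge0//.
Qed.

Lemma Lambda_ge0 Omega p : (0 <= Lambda Omega p)%E.
Proof.
by apply: le_ereal_inf_tmp => _ [u [G [_ _ ->]]]; exact: poweR_ge0.
Qed.

End Ls_norms.

(** * The smoothed cone *)

Section bump_test_function.
Context {R : realType} {n : nat}.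
Variables (Omega : set 'rV[R]_n) (x0 : 'rV[R]_n) (r delta eta : R).
Hypotheses (oO : open Omega) (ballO : forall x, enorm (x - x0) < r -> Omega x)
  (delta0 : 0 < delta) (eta0 : 0 < eta) (deltar : delta < r).

Let w := soft_norm x0 delta.
Let m : R := (r - delta) * cutoff eta 0 (r - delta).
(** [t * cutoff eta 0 t] is a smooth version of the positive part with slope at most 1. Dividing by
    [m], its value at [r - delta], makes the bump equal to 1 at [x0], where the soft norm is
    [delta]. *)
Let profile (t : R) : R := m^-1 * (t * cutoff eta 0 t).
Let bump (x : 'rV[R]_n) : R := profile (r - w x).

Let m_gt0 : 0 < m.
Proof.
by rewrite /m /cutoff subr_gt0 deltar expr0 mulr1 mulr_gt0 ?expR_gt0 ?subr_gt0.
Qed.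

Let is_derive_profile (t : R) : is_derive t (1 : R) profile
  (m^-1 * (cutoff eta 0 t + t * (eta * cutoff eta 2 t))).
Proof.
have dc := is_derive_cutoff eta0 0 t; rewrite mul0r subr0 in dc.
have := is_deriveZ m^-1 (is_deriveM (is_derive_id t (1 : R)) dc).
by congr (is_derive _ _ _ _); rewrite /GRing.scale /=; ring.
Qed.

(* [exp(-s) (1 + s) <= 1] with [s = eta / t] *)
Let profile'_le (t : R) :
  `|m^-1 * (cutoff eta 0 t + t * (eta * cutoff eta 2 t))| <= m^-1.
Proof.
have mV0 : 0 <= m^-1 by rewrite invr_ge0 ltW.
rewrite normrM (ger0_norm mV0) ler_piMr// /cutoff.
case: ifPn => t0; last by rewrite !mulr0 addr0 normr0.
have -> : expR (- (eta / t)) * t^-1 ^+ 0 +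
    t * (eta * (expR (- (eta / t)) * t^-1 ^+ 2)) =
    expR (- (eta / t)) * (1 + eta / t).
  by field; rewrite gt_eqF.
rewrite ger0_norm; last first.
  by rewrite mulr_ge0 ?expR_ge0// addr_ge0// divr_ge0 ?ltW.
by rewrite expRN mulrC ler_pdivrMr ?expR_gt0// mul1r expR_ge1Dx.
Qed.

(** Both factors of [t * exp(-eta/t)] increase with [t > 0], and [t = r - w x] is at most
    [r - delta]. *)
Let bump_le1 x : `|bump x| <= 1.
Proof.
have mV0 : 0 <= m^-1 by rewrite invr_ge0 ltW.
rewrite /bump /profile /cutoff; case: ifPn => t0; last first.
  by rewrite !mulr0 normr0.
have rd0 : 0 < r - delta by rewrite subr_gt0.
have le : r - w x <= r - delta by rewrite lerB// delta_le_soft_norm.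
rewrite expr0 mulr1 ger0_norm; last first.
  by rewrite mulr_ge0// mulr_ge0 ?expR_ge0 ?(ltW t0).
rewrite mulrC ler_pdivrMr// mul1r /m /cutoff rd0 expr0 mulr1.
apply: ler_pM => //; rewrite ?expR_ge0 ?(ltW t0)//.
by rewrite ler_expR lerN2 ler_pM2l// lef_pV2.
Qed.

Let bump_x0 : bump x0 = 1.
Proof. by rewrite /bump /w soft_norm0// /profile mulVf// gt_eqF. Qed.

(** The bump vanishes once the soft norm reaches [r], that is from [enorm (x - x0) ^+ 2 = r ^+ 2 -
    delta ^+ 2] on. As [delta > 0], even the closed support lies in the open ball of radius [r]. *)
Let bump_support : closure [set x | bump x != 0] `<=`
  [set x | enorm (x - x0) ^+ 2 <= r ^+ 2 - delta ^+ 2].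
Proof.
have cw : continuous (fun x : 'rV[R]_n => enorm (x - x0) ^+ 2).
  have ce := @continuous_enormB R n x0.
  by move=> x; exact: (cvgM (ce x) (ce x)).
have cl : closed [set x : 'rV[R]_n |
    enorm (x - x0) ^+ 2 <= r ^+ 2 - delta ^+ 2].
  have /continuous_closedP/(_ _ (@closed_le R (r ^+ 2 - delta ^+ 2))) := cw.
  exact.
rewrite [X in _ `<=` X]((closure_id _).1 cl); apply: closure_subset => y /=.
rewrite /bump /profile /cutoff; case: ifPn => [|_]; last by rewrite !mulr0 eqxx.
rewrite subr_gt0 => wr _.
rewrite lerBrDl -sqr_soft_norm//.
have y0 := soft_norm_gt0 x0 delta0 y.
by rewrite lerXn2r ?nnegrE ?(ltW y0) ?(ltW (lt_trans y0 wr)) ?(ltW wr).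
Qed.

(** Up to sign the gradient is the derivative of the profile times [(x - x0) / w x]; the first is at
    most [m^-1] in absolute value, the second at most 1 in norm. The bound tends to [1 / r] as
    [delta] and [eta] tend to 0. *)
Lemma bump_test_function : exists phi, [/\ test_function Omega phi,
  Ls_norm Omega +oo phi = 1%E
  & forall x, enorm (grad phi x) <=
      ((r - delta) * expR (- (eta / (r - delta))))^-1].
Proof.
have rad : radial x0 r delta eta bump.
  apply: radialM (radial_cst _ _ _ _ _) _.
  apply: radialM; last exact: radial_cutoff.
  rewrite (_ : (fun _ => _) = (fun x => r + -1 * w x)); last first.
    by apply/funext => x; rewrite mulN1r.
  apply: radialD (radial_cst _ _ _ _ _) _.
  exact: radialM (radial_cst _ _ _ _ _) (radial_norm _ _ _ _).
have r0 : 0 < r by exact: lt_trans deltar.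
have tf : test_function Omega bump.
  split; first exact: smooth_radial rad.
    apply: bounded_closed_compact; last exact: closed_closure.
    exists (`|x0| + r); split; first exact: num_real.
    move=> M Mr x /bump_support /= xr; apply: (le_trans _ (ltW Mr)).
    rewrite -[x](subrK x0) addrC (le_trans (ler_normD _ _))// lerD2l.
    rewrite (le_trans (norm_le_enorm _))//.
    rewrite -(@ler_pXn2r _ 2) ?nnegrE ?enorm_ge0 ?(ltW r0)//.
    by rewrite (le_trans xr)// gerBl sqr_ge0.
  move=> x /bump_support /= xr; apply: ballO.
  rewrite -(@ltr_pXn2r _ 2) ?nnegrE ?enorm_ge0 ?(ltW r0)//.
  by rewrite (le_lt_trans xr)// ltrBlDr ltrDl exprn_gt0.
exists bump; split=> //.
  apply: Ls_normy_sup => //.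
    exact: (continuous_radial delta0 eta0 rad).
  move=> e e0; exists x0; first by apply: ballO; rewrite subrr enorm0.
  by rewrite bump_x0 ltrBlDr ltrDl.
move=> x; rewrite (_ : (r - delta) * _ = m); last first.
  by rewrite /m /cutoff subr_gt0 deltar expr0 mulr1.
have w0 : 0 < w x by exact: soft_norm_gt0.
pose t := r - w x.
pose d := m^-1 * (cutoff eta 0 t + t * (eta * cutoff eta 2 t)).
have -> : grad bump x = (- d / w x) *: (x - x0).
  apply/rowP => i; rewrite !mxE.
  have dw : is_derive x (delta_mx ord0 i) (fun x => r - w x)
      (- ((x ord0 i - x0 ord0 i) / w x)).
    rewrite -[X in is_derive _ _ _ X]sub0r.
    exact: (is_deriveB (is_derive_cst _ _ _) (is_derive_soft_norm x0 delta0 x i)).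
  have := @is_derive_comp _ _ profile (fun x => r - w x) _ _ _ _
    (is_derive_profile t) dw.
  move=> /(@derive_val _ _ _ _ _ _ _) dE.
  transitivity (d * - ((x ord0 i - x0 ord0 i) / w x)); first exact: dE.
  by rewrite mulrN mulNr mulNr mulrA mulrAC.
rewrite enormZ normrM normrN normfV (gtr0_norm w0) -mulrA.
rewrite (le_trans _ (profile'_le t))// ler_piMr// mulrC ler_pdivrMr// mul1r.
exact: enorm_le_soft_norm.
Qed.

End bump_test_function.

(** * Lower bound on W_0^{1,p} *)

Section lower_bound.
Context {R : realType} {n : nat}.
Implicit Types (f g u phi : 'rV[R]_n -> R) (G H : 'rV[R]_n -> 'rV[R]_n).
Implicit Types (Omega : set 'rV[R]_n) (p : R).

Lemma le_Ls_norm Omega p f g : 0 < p -> measurable Omega ->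
  measurable_fun Omega f -> measurable_fun Omega g ->
  (forall x, Omega x -> `|f x| <= `|g x|) ->
  (Ls_norm Omega p%:E f <= Ls_norm Omega p%:E g)%E.
Proof.
move=> p0 mO mf mg fg; rewrite !Ls_normE//.
have mpow (h : 'rV[R]_n -> R) : measurable_fun Omega h ->
    measurable_fun Omega (fun x => (`|h x| `^ p)%:E).
  move=> mh; apply/measurable_EFinP.
  apply: (@measurableT_comp _ _ _ _ _ _ (@powR R ^~ p)).
    exact: measurable_powR.
  exact: measurableT_comp.
apply: gt0_ler_poweR.
- by rewrite invr_ge0 ltW.
- by rewrite in_itv /= leey andbT integral_ge0// => x _; rewrite lee_fin powR_ge0.
- by rewrite in_itv /= leey andbT integral_ge0// => x _; rewrite lee_fin powR_ge0.
apply: ge0_le_integral => //.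
- exact: mpow.
- exact: mpow.
- by move=> x Ox; rewrite lee_fin ge0_ler_powR ?nnegrE ?(ltW p0)// fg.
Qed.

(** Markov's inequality for [|f|^p] on [A], after taking p-th roots. *)
Lemma Ls_norm_ge Omega A p f (c : R) : 0 < p -> 0 <= c ->
  measurable Omega -> measurable A -> A `<=` Omega ->
  measurable_fun Omega f -> (forall x, A x -> c <= `|f x|) ->
  (c%:E * leb R n A `^ p^-1 <= Ls_norm Omega p%:E f)%E.
Proof.
move=> p0 c0 mO mA AO mf cf.
have mfp : measurable_fun Omega (fun x => (`|f x| `^ p)%:E).
  apply/measurable_EFinP.
  apply: (@measurableT_comp _ _ _ _ _ _ (@powR R ^~ p)).
    exact: measurable_powR.
  exact: measurableT_comp.
have -> : c%:E = ((c `^ p)%:E `^ p^-1)%E.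
  by rewrite poweR_EFin -powRrM divff ?gt_eqF// powRr1.
rewrite -poweRM ?lee_fin ?powR_ge0 ?measure_ge0// Ls_normE//.
apply: gt0_ler_poweR.
- by rewrite invr_ge0 ltW.
- by rewrite in_itv /= leey andbT mule_ge0 ?lee_fin ?powR_ge0.
- by rewrite in_itv /= leey andbT integral_ge0// => x _; rewrite lee_fin powR_ge0.
rewrite -integral_cst//.
apply: (@le_trans _ _ (\int[leb R n]_(x in A) (`|f x| `^ p)%:E)%E).
  apply: ge0_le_integral => //.
  - by move=> x _; rewrite lee_fin powR_ge0.
  - exact: (measurable_funS mO AO).
  - by move=> x Ax; rewrite lee_fin ge0_ler_powR ?nnegrE ?(ltW p0)// cf.
by apply: ge0_subset_integral => // x _; rewrite lee_fin powR_ge0.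
Qed.

Lemma measurable_enorm Omega G :
  (forall i, measurable_fun Omega (fun x => G x ord0 i)) ->
  measurable_fun Omega (fun x => enorm (G x)).
Proof.
move=> mG; apply: (@measurableT_comp _ _ _ _ _ _ (@Num.sqrt R)).
  by apply: continuous_measurable_fun; exact: sqrt_continuous.
by apply: measurable_sum => i; apply: measurable_funX.
Qed.

Lemma Ls_norm_enorm_triangle Omega p G H : 1 <= p -> measurable Omega ->
  (forall i, measurable_fun Omega (fun x => G x ord0 i)) ->
  (forall i, measurable_fun Omega (fun x => H x ord0 i)) ->
  (Ls_norm Omega p%:E (fun x => enorm (H x)) <=
   Ls_norm Omega p%:E (fun x => enorm (G x)) +
   Ls_norm Omega p%:E (fun x => enorm (G x - H x)%R))%E.
Proof.
move=> p1 mO mG mH; have p0 : 0 < p by exact: lt_le_trans p1.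
have mGH i : measurable_fun Omega (fun x => (G x - H x) ord0 i).
  rewrite (_ : (fun _ => _) = (fun x => G x ord0 i - H x ord0 i)).
    exact: measurable_funB.
  by apply/funext => x; rewrite !mxE.
pose g x := enorm (G x); pose d x := enorm (G x - H x).
have mg : measurable_fun Omega g by exact: measurable_enorm.
have md : measurable_fun Omega d by exact: measurable_enorm.
apply: (@le_trans _ _ (Ls_norm Omega p%:E (fun x => g x + d x))).
  apply: le_Ls_norm => //; first exact: measurable_enorm.
    exact: measurable_funD.
  move=> x _; rewrite !ger0_norm ?addr_ge0 ?enorm_ge0//.
  by rewrite /d enormB (le_trans _ (ler_enormD _ _))// addrC subrK.
have := @eminkowski _ _ _ (leb R n) (g \_ Omega) (d \_ Omega) p%:E
  (proj1 (measurable_restrictT g mO) mg) (proj1 (measurable_restrictT d mO) md).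
rewrite lee_fin => /(_ p1); rewrite /Ls_norm -!restrict_EFin.
congr (_ <= _)%E; congr Lnorm; apply/funext => x; rewrite /= !patchE.
by case: ifP; rewrite ?addr0.
Qed.

End lower_bound.

Section Lambda_lower_bound.
Context {R : realType} {n : nat}.
Variables (Omega : set 'rV[R]_n) (r p d : R).
Hypotheses (oO : open Omega) (bO : bounded_set Omega)
  (bd0 : (closure Omega `\` Omega°) !=set0)
  (rO : forall x, Omega x -> bdist Omega x <= r) (r0 : 0 < r)
  (p1 : 1 < p) (np : n%:R < p) (d0 : 0 < d).

Let p0 : 0 < p. Proof. exact: lt_trans p1. Qed.
Let mO : measurable Omega. Proof. exact: open_measurable_rV. Qed.
Let Ofin : (leb R n Omega < +oo)%E. Proof. exact: bounded_leb_fin. Qed.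

(** The constant of [morrey_bound] with [enorm (x - y)] replaced by [r] and [I^(1/p)], the norm of
    the gradient, factored out. *)
Definition morrey_constant : R :=
  (r + 2 * d * Num.sqrt n%:R) * ((d ^- n) `^ p^-1 / (1 - n%:R / p)).

Let c_gt0 : 0 < (d ^- n) `^ p^-1 / (1 - n%:R / p).
Proof.
rewrite divr_gt0 ?powR_gt0 ?invr_gt0 ?exprn_gt0//.
by rewrite subr_gt0 ltr_pdivrMr// mul1r.
Qed.

Lemma morrey_constant_gt0 : 0 < morrey_constant.
Proof.
by rewrite mulr_gt0// ltr_pwDl// !mulr_ge0 ?sqrtr_ge0 ?(ltW d0).
Qed.

(** A boundary point whose distance to [x] exceeds the infimum [bdist Omega x] only slightly stands
    for the nearest one. The boundary of an open set is disjoint from it, so [phi] vanishes there,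
    and the excess is then sent to 0. *)
Lemma test_function_le phi (L : R) : test_function Omega phi ->
  (Ls_norm Omega p%:E (fun x => enorm (grad phi x)) <= L%:E)%E ->
  forall x, Omega x -> `|phi x| <= morrey_constant * L.
Proof.
move=> tphi phiL x Ox; have [/smooth_C1 phi1 _ _] := tphi.
have [M phiM gradM] := test_function_bounded tphi.
have [K [cK clK KO phi0]] := test_function_support tphi.
pose I := fine (\int[leb R n]_x (enorm (grad phi x) `^ p)%:E)%E.
(* [grad phi] vanishes off [Omega], so the whole-space integral of [morrey_bound] is the norm on
   [Omega]. *)
have gE : (\int[leb R n]_x (enorm (grad phi x) `^ p)%:E =
    Ls_norm Omega p%:E (fun x => enorm (grad phi x)) `^ p)%E.
  rewrite powR_Ls_norm// [RHS]integral_mkcond; apply: eq_integral => y _.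
  rewrite patchE; case: ifPn => [_|yO]; first by rewrite ger0_norm ?enorm_ge0.
  rewrite (_ : grad phi y = 0) ?enorm0 ?powR0 ?gt_eqF//.
  apply/rowP => j; rewrite !mxE; apply: (pderive_support j clK phi0).
  by move=> /KO Oy; move: yO; rewrite mem_set.
have L0 : 0 <= L by rewrite -lee_fin (le_trans _ phiL)// Lnorm_ge0.
have gL : (\int[leb R n]_x (enorm (grad phi x) `^ p)%:E <= (L `^ p)%:E)%E.
  rewrite gE -poweR_EFin gt0_ler_poweR ?(ltW p0)//.
    by rewrite in_itv /= leey andbT Lnorm_ge0.
  by rewrite in_itv /= leey andbT lee_fin.
have g0 : (0 <= \int[leb R n]_x (enorm (grad phi x) `^ p)%:E)%E.
  by apply: integral_ge0 => y _; rewrite lee_fin powR_ge0.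
have gI : (\int[leb R n]_x (enorm (grad phi x) `^ p)%:E = I%:E)%E.
  by rewrite fineK// ge0_fin_numE// (le_lt_trans gL)// ltry.
have I0 : 0 <= I by rewrite fine_ge0.
have IL : I `^ p^-1 <= L.
  have -> : L = (L `^ p) `^ p^-1 by rewrite -powRrM divff ?gt_eqF// powRr1.
  by rewrite ge0_ler_powR ?nnegrE ?invr_ge0 ?powR_ge0 ?(ltW p0)// -lee_fin -gI.
have dn0 : 0 <= d ^- n by rewrite invr_ge0 exprn_ge0// ltW.
have c0 := c_gt0; set c := (d ^- n) `^ p^-1 / (1 - n%:R / p) in c0 *.
apply/ler_addgt0Pr => e e0.
(* The excess [e / (c L + 1)] is finally multiplied by [c L] and so costs at most [e]; adding 1
   covers [L = 0]. *)
have cL1 : 0 < c * L + 1 by rewrite ltr_wpDl// mulr_ge0// ltW.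
have [y yb ye] := bdist_adherent bd0 x (divr_gt0 e0 cL1).
have phiy : phi y = 0.
  by apply: phi0 => /KO; exact: boundary_notin yb.
have := morrey_bound phi1 phiM gradM p1 np gI x d0 phiy.
have cE (X : R) : X * (d ^- n * I) `^ p^-1 / (1 - n%:R / p) =
    X * (c * I `^ p^-1).
  by rewrite powRM// /c -!mulrA; congr (_ * (_ * _)); rewrite mulrC.
rewrite cE => /le_trans; apply.
have xy : enorm (x - y) <= r + e / (c * L + 1).
  by rewrite enormB (le_trans (ltW ye))// lerD2r rO.
have s0 : 0 <= 2 * d * Num.sqrt n%:R by rewrite !mulr_ge0 ?sqrtr_ge0// ltW.
apply: (@le_trans _ _ ((r + e / (c * L + 1) + 2 * d * Num.sqrt n%:R) * (c * L))).
  apply: ler_pM.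
  - by rewrite addr_ge0 ?enorm_ge0.
  - exact: mulr_ge0 (ltW c0) (powR_ge0 _ _).
  - by rewrite lerD2r.
  - by rewrite ler_wpM2l// ltW.
rewrite /morrey_constant -/c; move: (2 * d * _) s0 xy => S _ _.
have -> : (r + e / (c * L + 1) + S) * (c * L) =
  (r + S) * c * L + e / (c * L + 1) * (c * L) by ring.
by rewrite lerD2l mulrAC ler_pdivrMr// ler_wpM2l ?(ltW e0)// lerDl.
Qed.

Lemma measurable_superlevel (u : 'rV[R]_n -> R) (t : R) :
  measurable_fun Omega u ->
  measurable (Omega `&` [set x | (t < `|u x|)%R]).
Proof.
move=> mu.
have mau : measurable_fun Omega (fun x => `|u x|) by exact: measurableT_comp.
have := mau mO `]t, +oo[%classic (measurable_itv _).
congr measurable; congr (_ `&` _).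
by apply/seteqP; split=> x; rewrite /preimage /= in_itv /= andbT.
Qed.

(** If the set were null, [t] would be an essential upper bound of [|u|] below 1. The condition
    [0 <= t] takes care of the points off [Omega], where the extension is 0. *)
Lemma superlevel_gt0 (u : 'rV[R]_n -> R) (t : R) :
  0 <= t < 1 -> measurable_fun Omega u ->
  Omega !=set0 -> Ls_norm Omega +oo u = 1%E ->
  (0 < leb R n (Omega `&` [set x | (t < `|u x|)%R]))%E.
Proof.
move=> /andP[t0 t1] mu O0; rewrite Ls_normyE// => u1.
set A := _ `&` _.
have mA : measurable A by exact: measurable_superlevel.
rewrite lt0e measure_ge0 andbT; apply/eqP => A0.
have : (ess_sup (leb R n) (abse \o ((EFin \o u) \_ Omega)) <= t%:E)%E.
  apply/ess_supP; have /negligibleP := A0 => /(_ mA).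
  apply: negligibleS => x /=; rewrite patchE; case: ifPn => [|_].
    rewrite inE => Ox /negP; rewrite -ltNge /= lte_fin => tu.
    by split.
  by rewrite abse0 lee_fin.
by rewrite u1 lee_fin leNgt t1.
Qed.

(** By contradiction, with C the Morrey constant and [s = 1 - C gamma > 0]: a test function [phi]
    close to [u] satisfies [|phi| <= 1 - 3 s / 4] on [Omega], while [|u| > 1 - s / 4] on a set of
    positive measure. There the two differ by at least [s / 2], against closeness in L^p. *)
Lemma W01p_sup_le (u : 'rV[R]_n -> R) (G : 'rV[R]_n -> 'rV[R]_n)
    (gamma : R) :
  W01p Omega p u G -> Omega !=set0 ->
  Ls_norm Omega +oo u = 1%E ->
  Ls_norm Omega p%:E (fun x => enorm (G x)) = gamma%:E ->
  1 <= morrey_constant * gamma.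
Proof.
move=> [[[mu _] mG _] dense] O0 u1 Ggamma.
have C0 := morrey_constant_gt0.
have gamma0 : 0 <= gamma by rewrite -lee_fin -Ggamma Lnorm_ge0.
rewrite leNgt; apply/negP => Cg1.
pose s : R := 1 - morrey_constant * gamma.
have s0 : 0 < s by rewrite subr_gt0.
have Cg0 : 0 <= morrey_constant * gamma by rewrite mulr_ge0// ltW.
have t01 : 0 <= 1 - s / 4 < 1 by apply/andP; split; rewrite /s; lra.
have A0 := superlevel_gt0 t01 mu O0 u1.
set A := _ `&` _ in A0.
have mA : measurable A by exact: measurable_superlevel.
have Afin : (leb R n A < +oo)%E.
  by apply: (le_lt_trans _ Ofin); apply: le_measure; rewrite ?inE//; exact: subIsetl.
pose a := fine (leb R n A).
have aE : leb R n A = a%:E by rewrite fineK// ge0_fin_numE.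
have a0 : 0 < a by rewrite -lte_fin -aE.
(* The first bound gives [C e <= s / 4]; the second is the lower bound that Markov's inequality on
   [A] gives for the distance from [u] to [phi], [a] being the measure of [A]. *)
pose e : R := Num.min (s / (4 * morrey_constant)) (s / 2 * a `^ p^-1).
have e0 : 0 < e.
  rewrite lt_min; apply/andP; split.
    by rewrite divr_gt0// mulr_gt0.
  by rewrite mulr_gt0 ?powR_gt0 ?divr_gt0.
have [phi tphi] := dense e e0; rewrite /W1p_norm => close.
have [/smooth_C1 phi1 _ _] := tphi; have [cphi _ cdphi] := phi1.
have uphi : (Ls_norm Omega p%:E (fun x => u x - phi x)%R < e%:E)%E.
  by apply: le_lt_trans close; rewrite leeDl// Lnorm_ge0.
have Gphi : (Ls_norm Omega p%:E (fun x => enorm (G x - grad phi x)%R) < e%:E)%E.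
  by apply: le_lt_trans close; rewrite leeDr// Lnorm_ge0.
have mgrad i : measurable_fun Omega (fun x => grad phi x ord0 i).
  apply: measurable_funTS; rewrite (_ : (fun _ => _) = pderive i phi).
    exact: continuous_measurable_rV.
  by apply/funext => x; rewrite mxE.
have phiL : (Ls_norm Omega p%:E (fun x => enorm (grad phi x)) <=
    (gamma + e)%:E)%E.
  apply: (le_trans (Ls_norm_enorm_triangle (ltW p1) mO (fun i => (mG i).1) mgrad)).
  by rewrite EFinD Ggamma leeD2l// ltW.
have phile := test_function_le tphi phiL.
have Ce : morrey_constant * e <= s / 4.
  have : e <= s / (4 * morrey_constant) by rewrite /e ge_min lexx.
  have C4 : 0 < 4 * morrey_constant by exact: mulr_gt0.
  rewrite ler_pdivlMr// ler_pdivlMr//; apply: le_trans.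
  by rewrite [leRHS]mulrCA mulrC (mulrC e).
have gap x : A x -> s / 2 <= `|u x - phi x|.
  move=> [Ox /= xu]; have := phile x Ox; rewrite mulrDr => phix.
  have := lerB_dist (u x) (phi x); rewrite /s in xu Ce *; lra.
have mdiff : measurable_fun Omega (fun x => u x - phi x).
  apply: measurable_funB => //; apply: measurable_funTS.
  exact: continuous_measurable_rV.
have s2 : 0 <= s / 2 by lra.
have := Ls_norm_ge p0 s2 mO mA (@subIsetl _ _ _) mdiff gap.
move=> /le_lt_trans/(_ uphi); rewrite aE poweR_EFin -EFinM lte_fin.
by rewrite /e lt_min ltxx andbF.
Qed.

Lemma Lambda_ge : Omega !=set0 ->
  ((morrey_constant^-1 `^ p)%:E <= Lambda Omega p)%E.
Proof.
move=> O0; apply: le_ereal_inf_tmp => _ [u [G [uG u1 ->]]].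
have C0 := morrey_constant_gt0.
case E : (Ls_norm Omega p%:E (fun x => enorm (G x))) => [gamma||].
- have := W01p_sup_le uG O0 u1 E; rewrite -ler_pdivrMl// mulr1 => Cg.
  rewrite poweR_EFin lee_fin ge0_ler_powR ?nnegrE ?(ltW p0) ?invr_ge0 ?(ltW C0)//.
  by rewrite (le_trans _ Cg)// invr_ge0 ltW.
- by rewrite poweRyr ?gt_eqF// leey.
- by have := Lnorm_ge0 (leb R n) p%:E
    ((EFin \o (fun x => enorm (G x))) \_ Omega); rewrite -/(Ls_norm _ _ _) E.
Qed.

End Lambda_lower_bound.

(** * Limits as p tends to infinity *)

Section limits_at_infinity.
Context {R : realType}.
Implicit Types (f : R -> R) (V c l : R).

Lemma cvg_inv_pinfty c : c / p @[p --> +oo%R] --> 0.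
Proof.
apply/cvgrPdist_le => e e0; near=> p.
have p0 : 0 < p by near: p; exact: nbhs_pinfty_gt.
rewrite sub0r normrN normrM normfV (gtr0_norm p0) ler_pdivrMr// mulrC.
rewrite -ler_pdivrMr//; apply/ltW; near: p; exact: nbhs_pinfty_gt.
Unshelve. all: by end_near. Qed.

Lemma cvg_powR_inv V c : 0 < V -> V `^ (c / p) @[p --> +oo%R] --> (1 : R).
Proof.
move=> V0; have : expR (c / p * ln V) @[p --> +oo%R] --> expR (0 * ln V).
  apply: continuous_cvg; first exact: continuous_expR.
  exact: cvgM (cvg_inv_pinfty c) (cvg_cst _).
rewrite mul0r expR0; apply: cvg_trans; apply: near_eq_cvg.
by apply: nearW => p; rewrite /powR gt_eqF.
Qed.

Lemma cvg_ereal_sandwich (f : R -> \bar R) l :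
  (forall e : R, 0 < e ->
    \forall p \near +oo%R, ((l - e)%:E <= f p <= (l + e)%:E)%E) ->
  f p @[p --> +oo%R] --> l%:E.
Proof.
move=> fl; apply/fine_cvgP; split.
  apply: filterS (fl 1 ltr01) => p /andP[h1 h2].
  rewrite fin_numE; apply/andP; split; apply/eqP => fp.
    by move: h1; rewrite fp.
  by move: h2; rewrite fp.
apply/cvgrPdist_le => e e0; apply: filterS (fl e e0) => p /=.
case: (f p) => [x| |] /=.
- by rewrite !lee_fin ler_distlC => /andP[-> ->].
- by rewrite andbF.
- by [].
Qed.

Lemma cvg_morrey_constant n (r d : R) : 0 < d ->
  morrey_constant (n := n) r p d @[p --> +oo%R] -->
  r + 2 * d * Num.sqrt n%:R.
Proof.
move=> d0; rewrite -[X in _ --> X]mulr1; apply: cvgM; first exact: cvg_cst.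
rewrite -[X in _ --> X](divr1 1); apply: cvgM.
  have -> : (fun p : R => (d ^- n) `^ p^-1) = (fun p => (d ^- n) `^ (1 / p)).
    by apply/funext => p; rewrite div1r.
  by apply: cvg_powR_inv; rewrite invr_gt0 exprn_gt0.
apply: cvgV; first exact: oner_neq0.
rewrite -[X in _ --> X]subr0; apply: cvgB; first exact: cvg_cst.
exact: cvg_inv_pinfty.
Qed.

End limits_at_infinity.

Section Lambda_asymptotics.
Context {R : realType} {N : nat}.
Variables (Omega : set 'rV[R]_N) (r : R).
Hypotheses (oO : open Omega) (O0 : Omega !=set0) (bO : bounded_set Omega)
  (bd0 : (closure Omega `\` Omega°) !=set0) (r0 : 0 < r)
  (rO : forall x, Omega x -> bdist Omega x <= r)
  (Or : forall e : R, 0 < e -> exists2 x, Omega x & r - e < bdist Omega x).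

Let mO : measurable Omega. Proof. exact: open_measurable_rV. Qed.
Let Ofin : (leb R N Omega < +oo)%E. Proof. exact: bounded_leb_fin. Qed.
Let V := fine (leb R N Omega).
Let VE : leb R N Omega = V%:E. Proof. by rewrite fineK// ge0_fin_numE. Qed.
Let V0 : 0 < V.
Proof. by rewrite -lte_fin -VE; have [x Ox] := O0; exact: open_leb_gt0 Ox. Qed.

Lemma Lambda_root_ge (e : R) : 0 < e ->
  \forall p \near +oo%R, ((r^-1 - e)%:E <= Lambda Omega p `^ p^-1)%E.
Proof.
(* The second term of the maximum keeps [l] positive, hence invertible, even when [e >= r^-1]. *)
move=> e0; pose l : R := Num.max (r^-1 - e) (r^-1 / 2).
have rV0 : 0 < r^-1 by rewrite invr_gt0.
have l0 : 0 < l by rewrite lt_max; apply/orP; right; lra.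
have lr : l < r^-1 by rewrite gt_max; apply/andP; split; lra.
have rl : r < l^-1 by rewrite -ltf_pV2 ?posrE ?invr_gt0// invrK.
(* [4 d (sqrt N + 1)] is the gap between [r] and [l^-1], so [2 d sqrt N] takes at most half of it
   and the limit of the Morrey constant stays below [l^-1]. *)
pose d : R := (l^-1 - r) / (4 * (Num.sqrt N%:R + 1)).
have s1 : 0 < Num.sqrt N%:R + 1 :> R by rewrite ltr_wpDl ?sqrtr_ge0.
have d0 : 0 < d by rewrite divr_gt0 ?subr_gt0// mulr_gt0.
have dr : r + 2 * d * Num.sqrt N%:R < l^-1.
  have : d * (4 * (Num.sqrt N%:R + 1)) = l^-1 - r by rewrite divfK// gt_eqF// mulr_gt0.
  have : 0 <= d * Num.sqrt N%:R by rewrite mulr_ge0 ?sqrtr_ge0// ltW.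
  lra.
have Mlt := cvgr_lt _ (@cvg_morrey_constant R N r d d0) _ dr.
near=> p.
have p1 : 1 < p by near: p; exact: nbhs_pinfty_gt.
have Np : N%:R < p by near: p; exact: nbhs_pinfty_gt.
have M0 := morrey_constant_gt0 r0 p1 Np d0.
have Ml : morrey_constant (n := N) r p d < l^-1 by near: p; exact: Mlt.
have p0 : 0 < p by exact: lt_trans p1.
apply: (@le_trans _ _ ((morrey_constant (n := N) r p d)^-1)%:E).
  rewrite lee_fin (@le_trans _ _ l) ?le_max ?lexx//.
  by rewrite -[l]invrK lef_pV2 ?posrE ?invr_gt0// ltW.
have -> : ((morrey_constant (n := N) r p d)^-1)%:E =
    (((morrey_constant (n := N) r p d)^-1 `^ p)%:E `^ p^-1)%E.
  by rewrite poweR_EFin -powRrM divff ?gt_eqF// powRr1// invr_ge0 ltW.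
apply: gt0_ler_poweR.
- by rewrite invr_ge0 ltW.
- by rewrite in_itv /= leey andbT lee_fin powR_ge0.
- by rewrite in_itv /= leey andbT Lambda_ge0.
- exact: Lambda_ge.
Unshelve. all: by end_near. Qed.

Lemma Lambda_root_le (e : R) : 0 < e ->
  \forall p \near +oo%R, (Lambda Omega p `^ p^-1 <= (r^-1 + e)%:E)%E.
Proof.
move=> e0; pose l : R := r^-1 + e.
have rV0 : 0 < r^-1 by rewrite invr_gt0.
have l0 : 0 < l by rewrite addr_gt0.
have rl : l^-1 < r by rewrite -ltf_pV2 ?posrE ?invr_gt0// invrK ltrDl.
have lV0 : 0 < l^-1 by rewrite invr_gt0.
(* The length [k] serves three times: as the defect of [bdist Omega x] from [r], as [delta] and as
   [eta]. By [exp(-y) >= 1 - y], [m >= bdist Omega x - 2 k > r - 3 k], which exceeds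
   [l^-1 = r - 4 k]. *)
pose k : R := (r - l^-1) / 4.
have k0 : 0 < k by rewrite /k; lra.
have [x Ox xr] := Or k0.
have kx : k < bdist Omega x by rewrite /k in xr *; lra.
have [phi [tphi phi1 gphi]] := bump_test_function oO
  (fun z => @bdist_ball _ _ _ oO x z Ox) k0 k0 kx.
set m := (_ * _) in gphi.
have bk0 : 0 < bdist Omega x - k by rewrite subr_gt0.
have lm : l^-1 < m.
  apply: (@lt_le_trans _ _ ((bdist Omega x - k) * (1 - k / (bdist Omega x - k)))).
    rewrite mulrBr mulr1 mulrCA divff ?gt_eqF// mulr1.
    by rewrite /k in xr *; lra.
  rewrite ler_wpM2l ?(ltW bk0)//.
  by have := expR_ge1Dx (- (k / (bdist Omega x - k))).
have m0 : 0 < m by exact: lt_trans lm.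
have ml : m^-1 < l by rewrite -ltf_pV2 ?posrE ?invr_gt0// invrK.
have lim : m^-1 * V `^ (1 / p) @[p --> +oo%R] --> m^-1.
  rewrite -[X in _ --> X]mulr1; apply: cvgM; first exact: cvg_cst.
  exact: cvg_powR_inv.
have near_le := cvgr_lt _ lim _ ml.
near=> p.
have p0 : 0 < p by near: p; exact: nbhs_pinfty_gt.
apply: (@le_trans _ _ (m^-1 * V `^ (1 / p))%:E); last first.
  by rewrite lee_fin ltW//; near: p; exact: near_le.
have -> : (m^-1 * V `^ (1 / p))%:E = (((m^-1 `^ p)%:E * V%:E) `^ p^-1)%E.
  rewrite poweRM ?lee_fin ?powR_ge0 ?(ltW V0)// !poweR_EFin -EFinM div1r.
  by rewrite -powRrM divff ?gt_eqF// powRr1// invr_ge0 ltW.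
apply: gt0_ler_poweR.
- by rewrite invr_ge0 ltW.
- by rewrite in_itv /= leey andbT Lambda_ge0.
- by rewrite in_itv /= leey andbT mule_ge0 ?lee_fin ?powR_ge0 ?(ltW V0).
- by rewrite -VE; exact: Lambda_le gphi.
Unshelve. all: by end_near. Qed.

Lemma cvg_Lambda_root :
  (Lambda Omega p `^ p^-1)%E @[p --> +oo%R] --> (r^-1)%:E.
Proof.
apply: cvg_ereal_sandwich => e e0; near=> p; apply/andP; split; near: p.
  exact: Lambda_root_ge.
exact: Lambda_root_le.
Unshelve. all: by end_near. Qed.

(** The volume [V] is positive and finite, so the additional factor [V^(-1/p)] tends to 1. *)
Lemma cvg_Lambda_root_volume :
  (Lambda Omega p `^ p^-1 * leb R N Omega `^ (- p^-1))%E @[p --> +oo%R] -->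
  (r^-1)%:E.
Proof.
rewrite -[X in _ --> X]mule1; apply: cvgeM => //.
  exact: cvg_Lambda_root.
rewrite VE; apply: cvg_EFin; first by apply: nearW => p; rewrite poweR_EFin.
apply: cvg_trans (cvg_powR_inv (- 1) V0); apply: near_eq_cvg.
by apply: nearW => p /=; rewrite mulN1r.
Qed.

End Lambda_asymptotics.

Theorem theorem3p2 (R : realType) (N : nat) (Omega : set 'rV[R]_N)
    (N_ge2 : (2 <= N)%N)
    (Omega_nonempty : Omega !=set0)
    (Omega_open : open Omega)
    (Omega_connected : connected Omega)
    (Omega_bounded : bounded_set Omega)
    (Omega_smooth : smooth_boundary Omega) :
  (Lambda Omega p `^ p^-1)%E @[p --> +oo%R] -->
    ((Ls_norm Omega +oo (bdist Omega))^-1)%E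
  /\
  (Lambda Omega p `^ p^-1 * leb R N Omega `^ (- p^-1))%E @[p --> +oo%R] -->
    ((Ls_norm Omega +oo (bdist Omega))^-1)%E.
Proof.
have N0 : (0 < N)%N by exact: leq_trans N_ge2.
have bd0 := boundary_nonempty N0 Omega_open Omega_nonempty Omega_bounded.
have [r [r0 -> rO Or]] :=
  inradius N0 Omega_open Omega_nonempty Omega_bounded.
(* As [r] is positive, the inverse in the extended reals is the real inverse of [r]. *)
rewrite inver gt_eqF//; split; first exact: cvg_Lambda_root.
exact: cvg_Lambda_root_volume.
Qed.
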